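(* The bound $\mathrm{box}(G)\le 66\, t^{1/4}\lceil\log 4t\rceil^{3/4}+6$ for graphs $G$ with crossing number $t\geq 1$ is tight up to a factor of $O((\log t)^{1/4})$: there is a constant $c>0$ and graphs $G$ with arbitrarily large crossing number $t=CR(G)$ such that $\mathrm{box}(G)\ge c\,\dfrac{t^{1/4}(\log t)^{3/4}}{(\log t)^{1/4}}$.
   Context: Graphs are simple, finite and undirected; $\log$ is the natural logarithm. The crossing number $CR(G)$ is the minimum number of crossing pairs of edges over all drawings of $G$ in the plane. The boxicity $\mathrm{box}(G)$ is the minimum integer $k\ge0$ such that each vertex of $G$ can be assigned a $k$-box (a Cartesian product of $k$ closed intervals on the real line) so that two distinct vertices are adjacent iff their boxes intersect. *)

(* Defs.v *)
From HB Require Import structures.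
From mathcomp Require Import all_boot all_order all_algebra.
From mathcomp Require Import all_classical all_reals all_analysis.

Set Implicit Arguments.
Unset Strict Implicit.
Unset Printing Implicit Defensive.

Import Order.TTheory GRing.Theory Num.Theory.
Import numFieldNormedType.Exports.

Local Open Scope classical_set_scope.
Local Open Scope ring_scope.

Record sgraph := SGraph {
  vertex :> finType;
  adj : rel vertex;
  adj_sym : symmetric adj;
  adj_irr : irreflexive adj }.

Definition edges (G : sgraph) : {set {set G}} :=
  [set [set p.1; p.2]%SET | p in [pred p : G * G | adj p.1 p.2]]%SET.

(* 0 when [A] is empty. *)
Definition nat_min (A : set nat) : nat :=
  xget 0%N [set n | A n /\ forall m, A m -> (n <= m)%N].

(* Edges are drawn as simple arcs, parametrized by [0, 1] in either direction,
   whose relative interiors avoid all the vertices. Intersections of arcs are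
   not restricted any further (they may be infinite, tangential, or shared by
   more than two arcs): any common interior point makes the pair of edges
   count as crossing. *)
Record drawing (R : realType) (G : sgraph) := Drawing {
  position : G -> R * R;
  curve : {set G} -> R -> R * R;
  position_inj : injective position;
  curve_continuous : forall f : {set G}, f \in edges G ->
    {within `[0, 1], continuous (curve f)};
  curve_simple : forall f : {set G}, f \in edges G ->
    {in `[0, 1] &, injective (curve f)};
  curve_ends : forall u v : G, adj u v ->
    (curve [set u; v]%SET 0 = position u /\ curve [set u; v]%SET 1 = position v) \/
    (curve [set u; v]%SET 0 = position v /\ curve [set u; v]%SET 1 = position u);
  curve_avoids : forall f : {set G}, f \in edges G ->
    forall s : R, s \in `]0, 1[ -> forall v : G, curve f s != position v }.

Definition crosses (R : realType) (G : sgraph) (D : drawing R G)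
    (f g : {set G}) : Prop :=
  exists s t : R, [/\ s \in `]0, 1[, t \in `]0, 1[ & curve D f s = curve D g t].

Definition crossing_pairs (R : realType) (G : sgraph) (D : drawing R G) :
    {set {set {set G}}} :=
  [set [set p.1; p.2]%SET | p in [pred p : {set G} * {set G} |
     [&& p.1 \in edges G, p.2 \in edges G, p.1 != p.2
       & `[< crosses D p.1 p.2 >]]]]%SET.

Definition crossing_number (R : realType) (G : sgraph) : nat :=
  nat_min [set #|crossing_pairs D| | D in [set: drawing R G]].

Definition box (R : realType) (k : nat) (a b : 'rV[R]_k) : set 'rV[R]_k :=
  [set x | forall i, x 0 i \in `[a 0 i, b 0 i]].

(* For k = 0 the only box is the one-point space, so that the complete graphs
   are the graphs of boxicity 0. *)
Definition box_representation (R : realType) (G : sgraph) (k : nat)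
    (a b : G -> 'rV[R]_k) : Prop :=
  (forall v i, a v 0 i <= b v 0 i) /\
  (forall u v, u != v ->
     adj u v <-> box (a u) (b u) `&` box (a v) (b v) !=set0).

Definition boxicity (R : realType) (G : sgraph) : nat :=
  nat_min [set k | exists a b : G -> 'rV[R]_k, box_representation a b].

Definition boxicity_bound (R : realType) (t : nat) : R :=
  66 * t%:R `^ (1 / 4) * (Num.ceil (ln (4 * t%:R : R)))%:~R `^ (3 / 4) + 6.

(* Main.v *)
Require Import Defs.
From mathcomp Require Import all_boot all_order all_algebra.
From mathcomp Require Import zify ring lra.

(** Write t for the crossing number, m for the number of edges. Trivially
    t <= m^2, so it suffices to find graphs with boxicity at least a constant
    times sqrt(m log m). Take a random bipartite graph between two sets of size
    n = 16^p with edge probability 1/q, where q = 4p is log_2 n: it has O(n^2/q)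
    edges, and its boxicity is at least n/128. Indeed each coordinate of a box
    representation reverses two "Ferrers" sets {(a, b) : r a < l b} of non-edges,
    and these must cover all non-edges. As the random graph has no empty
    s x s rectangle for s = 3q^2, only the first s elements of each order matter,
    so that there are at most n^(2sk) configurations of k orders. For a fixed
    configuration with k <= n/64 a non-edge (a, b) remains uncovered if the graph
    hits all the initial segments preceding (a, b); for a well chosen (a, b) this
    has probability at least 2^(-p-1), and depends on polylog(n) of the random
    bits only, so there are 2^(6p) independent trials, more than enough for the
    union bound. Disjoint copies of K_5 make t arbitrarily large: K_5 has no
    crossing-free drawing, since otherwise the parities of the numbers of
    crossings of the (sampled) edges with the horizontal rays issued from the
    vertices would satisfy an inconsistent linear system over F_2. *)

Set Implicit Arguments.
Unset Strict Implicit.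
Unset Printing Implicit Defensive.

Import Order.TTheory GRing.Theory Num.Theory.
Local Open Scope ring_scope.

(** * Events over independent uniform variables *)

Section Independence.
Variables (I T : finType).
Implicit Types (f g : {ffun I -> T}) (U V : {set I}) (A B : {set {ffun I -> T}}).

Definition Pr A : rat := #|A|%:R / #|{ffun I -> T}|%:R.

Definition depends_on A U :=
  forall f g, {in U, f =1 g} -> (f \in A) = (g \in A).

Definition splice U f g : {ffun I -> T} := [ffun i => if i \in U then f i else g i].

Lemma depends_onS A U V : U \subset V -> depends_on A U -> depends_on A V.
Proof. by move=> /subsetP sUV dA f g fg; apply: dA => i /sUV/fg. Qed.

Lemma depends_onI A B U : depends_on A U -> depends_on B U -> depends_on (A :&: B) U.
Proof. by move=> dA dB f g fg; rewrite !inE (dA f g) ?(dB f g). Qed.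

Lemma depends_onC A U : depends_on A U -> depends_on (~: A) U.
Proof. by move=> dA f g fg; rewrite !inE (dA f g). Qed.

(** Exchanging the coordinates outside [U] between two functions is an involution of pairs; it
    identifies the pairs with first component in [A :&: B] with the product of [A] and [B]. *)
Lemma card_indep A B U : depends_on A U -> depends_on B (~: U) ->
  (#|A :&: B| * #|{ffun I -> T}| = #|A| * #|B|)%N.
Proof.
move=> dA dB; rewrite -cardsT -!cardsX.
pose swap (p : {ffun I -> T} * {ffun I -> T}) := (splice U p.1 p.2, splice U p.2 p.1).
have swapK : involutive swap.
  by case=> f g; apply/eqP; rewrite xpair_eqE; apply/andP; split;
    apply/eqP/ffunP=> i; rewrite !ffunE /= ?ffunE; case: (i \in U).
rewrite -(card_preimset (setX A B) (inv_inj swapK)); apply: eq_card => -[f g].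
rewrite !inE /= andbT; congr andb.
  by apply: dA => i iU; rewrite ffunE iU.
by apply: dB => i; rewrite inE ffunE => /negbTE ->.
Qed.

Hypothesis T0 : (0 < #|T|)%N.

Lemma card_ffun_gt0 : (0 < #|{ffun I -> T}|)%N.
Proof. by rewrite card_ffun expn_gt0 T0. Qed.

Lemma Pr_indep A B U : depends_on A U -> depends_on B (~: U) ->
  Pr (A :&: B) = Pr A * Pr B.
Proof.
move=> dA dB; have := card_indep dA dB; rewrite /Pr => /(congr1 (fun n => n%:R : rat)).
have := card_ffun_gt0; rewrite -(ltr0n rat) !natrM => N0 E.
by rewrite mulf_div -E; field; rewrite gt_eqF.
Qed.

Lemma Pr_le A B : A \subset B -> Pr A <= Pr B.
Proof. by move=> AB; apply: ler_wpM2r; rewrite ?invr_ge0 ?ler0n// ler_nat subset_leq_card. Qed.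

Lemma PrT : Pr setT = 1.
Proof. by rewrite /Pr cardsT divff// pnatr_eq0 -lt0n card_ffun_gt0. Qed.

Lemma PrC A : Pr (~: A) = 1 - Pr A.
Proof.
rewrite -PrT /Pr -mulrBl cardsCs setCK cardsT natrB//.
exact: max_card.
Qed.

Lemma Pr_ge0 A : 0 <= Pr A.
Proof. by rewrite /Pr divr_ge0. Qed.

Lemma Pr_le1 A : Pr A <= 1.
Proof. by rewrite -PrT Pr_le ?subsetT. Qed.

Lemma Pr_split A B : Pr A = Pr (A :&: B) + Pr (A :&: ~: B).
Proof. by rewrite /Pr -mulrDl -natrD -(cardsID B A) setDE. Qed.

Lemma Pr_setU A B : Pr (A :|: B) <= Pr A + Pr B.
Proof. rewrite /Pr -mulrDl -natrD; apply: ler_wpM2r; rewrite ?invr_ge0 ?ler0n//.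
by rewrite ler_nat leq_card_setU. Qed.

Lemma Pr_bigcup (J : finType) (F : J -> {set {ffun I -> T}}) e :
  (forall j, Pr (F j) <= e) -> Pr (\bigcup_j F j) <= #|J|%:R * e.
Proof.
move=> Fe; apply: (@le_trans _ _ (\sum_j Pr (F j))).
  elim/big_rec2: _ => [|j y1 y2 _ le12]; first by rewrite /Pr cards0 mul0r.
  by apply: le_trans (Pr_setU _ _) _; rewrite lerD2l.
by apply: le_trans (ler_sum _ (fun j _ => Fe j)) _; rewrite sumr_const mulr_natl.
Qed.

End Independence.

(** * Hitting sets by a random set of density 1/q *)

Section Hits.
Variables (I : finType) (q' : nat).
Let q := q'.+1.
Local Notation T := 'I_q.
Implicit Types (f : {ffun I -> T}) (U V : {set I}).

(** The value [ord0], taken with probability 1/q, marks an edge of the random graph. *)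
Definition hit U : {set {ffun I -> T}} :=
  [set f : {ffun I -> T} | [exists i in U, f i == ord0]].

Let x : rat := 1 - q%:R^-1.

Lemma miss_prob_ge0 : 0 <= x. Proof. by rewrite subr_ge0 invf_le1 ?ler1n ?ltr0n. Qed.
Lemma miss_prob_le1 : x <= 1. Proof. by rewrite gerBl invr_ge0 ler0n. Qed.

Lemma depends_on_hit U : depends_on (hit U) U.
Proof.
move=> f g fg; rewrite !inE; apply: eq_existsb => i.
by case: (boolP (i \in U)) => //= /fg ->.
Qed.

Lemma Pr_miss U : Pr (~: hit U) = x ^+ #|U|.
Proof.
have T0 : (0 < #|'I_q|)%N by rewrite card_ord.
pose F (i : I) : pred T := if i \in U then [pred t | t != ord0] else predT.
rewrite /Pr; have -> : #|~: hit U| = #|(family F : simpl_pred {ffun I -> T})|.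
  apply: eq_card => f; rewrite !inE; apply/existsPn/familyP => [mf i|mf i].
    by rewrite /F; case: ifP => // iU; have := mf i; rewrite iU.
  by have := mf i; rewrite /F; case: ifP => //= _; rewrite inE.
rewrite card_family card_ffun card_ord foldrE big_map big_enum /=.
rewrite (bigID (mem U)) /= (eq_bigr (fun=> q')); last first.
  move=> i iU; rewrite /F iU.
  have := cardC1 (ord0 : T); rewrite card_ord /= => E; rewrite -[RHS]E.
  exact: eq_card.
rewrite [X in (_ * X)%N](eq_bigr (fun=> q)); last first.
  by move=> i /negbTE iU; rewrite /F iU; rewrite -[RHS]card_ord.
rewrite !prod_nat_const -(cardC U) expnD !natrM !natrX.
have -> : #|[pred i | i \notin U]| = #|[predC U]| by apply: eq_card.
rewrite -mulf_div divff ?mulr1; last by rewrite expf_eq0 pnatr_eq0 andbF.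
rewrite -expr_div_n; congr (_ ^+ _).
by rewrite /x /q -natr1; field; rewrite natr1 pnatr_eq0.
Qed.

(* A miss of U decouples from the other hits after restricting them to the
   complement of U, which only makes them rarer. *)
Lemma Pr_hits (l : seq {set I}) :
  \prod_(U <- l) (1 - x ^+ #|U|) <= Pr (\bigcap_(U <- l) hit U).
Proof.
have T0 : (0 < #|'I_q|)%N by rewrite card_ord.
elim: l => [|U l IH]; first by rewrite !big_nil PrT.
rewrite !big_cons; set H := \bigcap_(V <- l) hit V in IH *.
have xU : 0 <= 1 - x ^+ #|U| by rewrite subr_ge0 exprn_ile1 ?miss_prob_ge0 ?miss_prob_le1.
apply: le_trans (ler_wpM2l xU IH) _.
pose HU := \bigcap_(V <- l) hit (V :\: U).
have memcap (P : {set I} -> {set {ffun I -> T}}) f :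
    (f \in \bigcap_(V <- l) P V) = all (fun V => f \in P V) l.
  elim: (l) => [|V l' IHl]; first by rewrite big_nil inE.
  by rewrite big_cons inE IHl.
have sHU : HU \subset H.
  apply/subsetP => f; rewrite !memcap; apply: sub_all => V.
  rewrite !inE => /existsP[i /andP[]]; rewrite inE => /andP[_ iV] fi.
  by apply/existsP; exists i; rewrite iV.
have dHU : depends_on HU (~: U).
  move=> f g fg; rewrite !memcap; apply: eq_all => V.
  apply: depends_on_hit => i; rewrite inE => /andP[iU _].
  by apply: fg; rewrite inE.
have EH : H :&: ~: hit U = ~: hit U :&: HU.
  apply/setP=> f; rewrite !inE !memcap andbC.
  case: (boolP [exists i in U, f i == ord0]) => //= /existsPn mf.
  apply: eq_all => V; rewrite !inE; apply: eq_existsb => i; rewrite inE.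
  by have := mf i; case: (i \in U) => //= /negbTE ->; rewrite andbF.
have := Pr_split H (hit U); rewrite EH (Pr_indep T0 (A := ~: hit U) (U := U))//; last first.
  by apply: depends_onC; apply: depends_on_hit.
rewrite Pr_miss setIC => E.
have := Pr_le sHU; move: E => ->.
have := exprn_ge0 #|U| miss_prob_ge0; set y := x ^+ _; nra.
Qed.

End Hits.

(** * Uncovered points of a family of lists *)

Section EulerProduct.
Variables (F : realFieldType) (q' : nat).
Let q := q'.+1.
Let x : F := 1 - q%:R^-1.

Let q_gt0 : 0 < q%:R :> F. Proof. by rewrite ltr0n. Qed.
Let x0 : 0 <= x. Proof. by rewrite subr_ge0 invf_le1 ?ler1n. Qed.
Let x1 : x <= 1. Proof. by rewrite gerBl invr_ge0 ltW. Qed.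

Let half_ge0 : 0 <= 2^-1 :> F. Proof. by rewrite invr_ge0. Qed.
Let half_gt0 : 0 < 2^-1 :> F. Proof. by rewrite invr_gt0. Qed.
Let half_le1 : 2^-1 <= 1 :> F. Proof. lra. Qed.
Let quarter_ge0 : 0 <= 4^-1 :> F. Proof. by rewrite invr_ge0. Qed.
Let quarter_le1 : 4^-1 <= 1 :> F. Proof. lra. Qed.

(** The left side does not increase with j, since (1 - 1/q)(q + j + 1) = q + j - (j + 1)/q. *)
Lemma expr_le_bernoulli j : x ^+ j * (q + j)%:R <= q%:R.
Proof.
elim: j => [|j IH]; first by rewrite expr0 mul1r addn0.
apply: le_trans IH; rewrite exprSr -mulrA ler_wpM2l ?exprn_ge0//.
rewrite addnS -natr1 /x natrD mulrBl mul1r lerBlDr -lerBlDl mulrC ler_pdivlMr//.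
have : 0 <= j%:R :> F by rewrite ler0n.
nra.
Qed.

Lemma expr_le_half : x ^+ q <= 2^-1.
Proof.
have := expr_le_bernoulli q; rewrite natrD.
move: q_gt0; set y := x ^+ q; set Q := q%:R => Q0 le.
by rewrite -(ler_pM2r Q0); lra.
Qed.

Lemma bin_le_exp2 n m : ('C(n, m) <= 2 ^ n)%N.
Proof.
elim: n m => [|n IH] [|m] //; first by rewrite bin0 expn_gt0.
by rewrite binS expnS mul2n -addnn leq_add.
Qed.

(** By [expr_le_bernoulli] the factor 1 - x^j is at least j/(q + j), and the product of these
    fractions for j = 1, ..., m is the inverse of the binomial coefficient ['C(q + m, m)]. *)
Lemma prod_first_block m :
  2^-1 ^+ (q + m) <= \prod_(j < m) (1 - x ^+ j.+1).
Proof.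
apply: (@le_trans _ _ (('C(q + m, m))%:R^-1)).
  rewrite exprVn lef_pV2 ?posrE ?exprn_gt0 ?ltr0n ?bin_gt0 ?leq_addl//.
  by rewrite -natrX ler_nat bin_le_exp2.
elim: m => [|m IH]; first by rewrite big_ord0 bin0 invr1.
rewrite big_ord_recr /=.
have F0 : 0 <= 1 - x ^+ m.+1 by rewrite subr_ge0 exprn_ile1.
apply: le_trans (ler_wpM2r F0 IH).
have := expr_le_bernoulli m.+1.
have := mul_bin_diag (q + m.+1) m; rewrite addnS /= -addnS.
move=> /(congr1 (fun n => n%:R : F)); rewrite !natrM.
have : 0 < 'C(q + m, m)%:R :> F by rewrite ltr0n bin_gt0 leq_addl.
have : 0 < 'C(q + m.+1, m.+1)%:R :> F by rewrite ltr0n bin_gt0 leq_addl.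
rewrite -natr1 natrD -natr1.
have : 0 <= m%:R :> F by rewrite ler0n.
set a := 'C(_, _)%:R; set b := 'C(_, _)%:R; set y := x ^+ _.
set Q := q%:R; set M := m%:R => M0 a0 b0 E le.
rewrite mulrC ler_pdivlMr// mulrC ler_pdivrMr//.
have Q0 : 0 < Q by rewrite ltr0n.
have : 0 < Q + (M + 1) by lra.
move=> S0; rewrite -(ler_pM2l S0).
have -> : (Q + (M + 1)) * b = (M + 1) * a by rewrite -E; ring.
nra.
Qed.

Lemma prod_halves R : 4^-1 <= \prod_(r < R) (1 - 2^-1 ^+ r.+1) :> F.
Proof.
case: R => [|R]; first by rewrite big_ord0; lra.
(* The additional term makes the bound inductive; it is an equality for a single factor. *)
suff : 4^-1 + 2^-1 ^+ R.+2 <= \prod_(r < R.+1) (1 - 2^-1 ^+ r.+1) :> F.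
  have : 0 <= 2^-1 ^+ R.+2 :> F by rewrite exprn_ge0.
  lra.
elim: R => [|R IH]; first by rewrite big_ord_recr big_ord0 /=; lra.
rewrite big_ord_recr /=.
have h0 : 0 <= 2^-1 ^+ R.+2 :> F by rewrite exprn_ge0.
have h1 : 2^-1 ^+ R.+2 <= 4^-1 :> F.
  rewrite !exprSr; have : 2^-1 ^+ R <= 1 :> F by rewrite exprn_ile1//; lra.
  have : 0 <= 2^-1 ^+ R :> F by rewrite exprn_ge0.
  by nra.
rewrite [2^-1 ^+ R.+3]exprSr.
set h := 2^-1 ^+ R.+2 in IH h0 h1 *; set P := (X in _ <= X) in IH; set P' := (X in _ <= X * _); have <- : P = P' by [].
nra.
Qed.

(** Cut the product into blocks of length q. The first block is at least 4^-q. As x^q is at most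
    1/2, each factor of the r-th later block is at least 1 - 2^-r, so that all later blocks together
    contribute at least the q-th power of [prod_halves], again 4^-q. *)
Lemma euler_prod s : 16^-1 ^+ q <= \prod_(j < s) (1 - x ^+ j.+1).
Proof.
have x01 n : 0 <= 1 - x ^+ n.+1 <= 1.
  by rewrite subr_ge0 exprn_ile1//= gerBl exprn_ge0.
have xq := expr_le_half.
have -> : 16^-1 ^+ q = 2^-1 ^+ (q + q) * 4^-1 ^+ q :> F.
  by rewrite exprD -!exprMn; congr (_ ^+ _); lra.
apply: (@le_trans _ _ (\prod_(j < q + s * q) (1 - x ^+ j.+1))); last first.
  have : (s <= q + s * q)%N by rewrite /q; nia.
  move: (q + s * q)%N => m sm.
  rewrite -!(big_mkord xpredT (fun j => 1 - x ^+ j.+1)) (big_cat_nat (n := s))//=.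
  apply: ler_piMr; first by apply: prodr_ge0 => j _; case/andP: (x01 j).
  by apply: prodr_ile1 => j _.
rewrite big_split_ord /= ler_pM ?exprn_ge0//; first exact: prod_first_block.
apply: (@le_trans _ _ (\prod_(r < s) (1 - 2^-1 ^+ r.+1) ^+ q)).
  rewrite prodrXl; apply: lerXn2r; rewrite ?nnegrE// ?prod_halves//.
  exact: le_trans (prod_halves s).
elim: s => [|s IH]; first by rewrite big_ord0 mul0n big_ord0.
rewrite big_ord_recr /= mulSn addnC big_split_ord /=.
apply: ler_pM => //.
- apply: prodr_ge0 => r _; rewrite exprn_ge0// subr_ge0 exprn_ile1//; lra.
- rewrite exprn_ge0// subr_ge0 exprn_ile1//; lra.
rewrite -[X in _ ^+ X]card_ord -prodr_const; apply: ler_prod => i _.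
rewrite subr_ge0 exprn_ile1 ?lerB//=; try lra.
have -> : (q + (s * q + i)).+1 = (q * s.+1 + i.+1)%N.
  by rewrite mulnS addnS addnA [(s * q)%N]mulnC.
rewrite exprD exprM; apply: (@le_trans _ _ ((x ^+ q) ^+ s.+1)).
  by rewrite ler_piMr ?exprn_ge0// exprn_ile1.
by apply: lerXn2r; rewrite ?nnegrE ?exprn_ge0//; lra.
Qed.

End EulerProduct.

Lemma prod_uniq_sub (g : nat -> rat) (r1 r2 : seq nat) :
  (forall j, 0 <= g j <= 1) -> uniq r1 -> {subset r1 <= r2} -> uniq r2 ->
  \prod_(j <- r2) g j <= \prod_(j <- r1) g j.
Proof.
move=> g01 u1 s12 u2.
have pe : perm_eq r2 (r1 ++ [seq j <- r2 | j \notin r1]).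
  apply: uniq_perm => //.
    rewrite cat_uniq u1 filter_uniq// andbT /=; apply/hasPn => j.
    by rewrite mem_filter => /andP[].
  by move=> j; rewrite mem_cat mem_filter; case: (boolP (j \in r1)) => //= /s12.
rewrite (perm_big _ pe) big_cat /=; apply: ler_piMr.
  by apply: prodr_ge0 => j _; case/andP: (g01 j).
by apply: prodr_ile1 => j _; apply: g01.
Qed.

(** * Counting the candidates for uncovered points *)

Section Uncovered.
Variables (I J : finType) (lam : J -> seq I) (s : nat).
Hypothesis size_lam : forall j, (size (lam j) <= s)%N.
Implicit Types (v w : I) (j : J) (Z : {set I}).

(** For [v] outside [l] the index is the length of [l], so that the whole list precedes [v]. *)
Definition before v (l : seq I) : {set I} := [set w in take (index v l) l].

Definition deg v := #|[set j | v \in lam j]|.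

Lemma notin_before v l : v \notin before v l.
Proof. by rewrite inE in_take_leq ?index_size// ltnn. Qed.

Lemma mem_before v w l : (index w l < index v l)%N -> w \in before v l.
Proof. by move=> lt; rewrite inE in_take_leq ?index_size. Qed.

Lemma subset_before v w l : (index w l <= index v l)%N ->
  before w l \subset before v l.
Proof.
move=> le; apply/subsetP => z; rewrite !inE !in_take_leq ?index_size// => lt.
exact: leq_trans lt le.
Qed.

Lemma card_before v l : v \in l -> (#|before v l| < size l)%N.
Proof.
rewrite -index_mem => lt; apply: leq_ltn_trans lt.
rewrite cardsE; apply: leq_trans (card_size _) _; rewrite size_take.
by case: ifP => // /negbT; rewrite -leqNgt.
Qed.

Let u Z j v := #|before v (lam j) :\: Z|.

(** Of two points of the list outside [Z], the later one counts in addition the earlier one, hence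
    has the larger number. *)
Lemma card_before_inj Z j : {in [pred v | v \in lam j & v \notin Z] &, injective (u Z j)}.
Proof.
have lt v w : w \in lam j -> w \notin Z -> (index w (lam j) < index v (lam j))%N ->
    (u Z j w < u Z j v)%N.
  move=> wl wZ wv; apply: proper_card; apply/properP; split.
    exact/setSD/subset_before/ltnW.
  exists w; first by rewrite inE wZ mem_before.
  by rewrite inE (negbTE (notin_before _ _)) andbF.
move=> v w; rewrite !inE => /andP[vl vZ] /andP[wl wZ] E.
case: (ltngtP (index v (lam j)) (index w (lam j))) => [/(lt _ _ vl vZ)|/(lt _ _ wl wZ)|].
- by rewrite E ltnn.
- by rewrite E ltnn.
by move=> /(congr1 (nth v (lam j))); rewrite !nth_index.
Qed.

Lemma card_before_lt Z j v : v \in lam j -> (u Z j v < s)%N.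
Proof.
move=> vl; apply: leq_trans (size_lam j); apply: leq_ltn_trans (card_before vl).
exact/subset_leq_card/subsetDl.
Qed.

(** [Z] holds the variables already exposed. The degree bound keeps the trial at [v] dependent on
    few variables, and the last condition keeps each initial segment before [v] hittable outside
    [Z]. *)
Definition candidates Z := [set v | [&& v \notin Z, (deg v <= s)%N &
  [forall j, (v \in lam j) ==> (0 < u Z j v)%N]]].

(** Besides [Z], two kinds of points are lost: those of degree above [s], at most [#|J|] by double
    counting incidences, and the first point outside [Z] of each list, again at most [#|J|]. *)
Lemma card_candidates Z : (#|I| <= #|candidates Z| + #|Z| + 2 * #|J|)%N.
Proof.
pose heavy := [set v | (s < deg v)%N].
pose tops := \bigcup_j [set v | [&& v \in lam j, v \notin Z & u Z j v == 0]]%N.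
have cheavy : (#|heavy| <= #|J|)%N.
  have : (#|heavy| * s.+1 <= #|J| * s)%N.
    rewrite -sum_nat_const; apply: (@leq_trans (\sum_(v in heavy) deg v)).
      by apply: leq_sum => v; rewrite inE.
    apply: (@leq_trans (\sum_v deg v)).
      by rewrite [X in (_ <= X)%N](bigID (mem heavy)) /= leq_addr.
    under eq_bigr do rewrite /deg -sum1dep_card.
    rewrite (exchange_big_dep xpredT)//= -sum_nat_const leq_sum// => j _.
    rewrite sum1dep_card; apply: leq_trans (size_lam j).
    apply: leq_trans (card_size _); apply: subset_leq_card.
    by apply/subsetP => v; rewrite inE.
  nia.
have ctops : (#|tops| <= #|J|)%N.
  rewrite -[X in (_ <= X)%N]sum1_card /tops.
  elim/big_rec2: _ => [|j n T _ IH]; first by rewrite cards0.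
  apply: leq_trans (leq_card_setU _ _).1 _; apply: leq_add => //.
  apply/card_le1_eqP => v w; rewrite !inE => /and3P[vl vZ /eqP v0] /and3P[wl wZ /eqP w0].
  by apply: (@card_before_inj Z j); rewrite ?inE ?vl ?wl ?vZ ?wZ// v0 w0.
have sub : [set: I] \subset candidates Z :|: Z :|: (heavy :|: tops).
  apply/subsetP => v _; rewrite !inE; case: (boolP (v \in Z)) => //= vZ.
  rewrite ?orbF leqNgt; case: (s < deg v)%N => //=.
  case: (boolP [forall j, _]) => //= /forallPn[j].
  rewrite negb_imply -leqNgt leqn0 => /andP[vl v0].
  by apply/bigcupP; exists j => //; rewrite inE vl vZ.
have := subset_leq_card sub; rewrite cardsT.
have := (leq_card_setU (candidates Z :|: Z) (heavy :|: tops)).1.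
have := (leq_card_setU (candidates Z) Z).1.
have := (leq_card_setU heavy tops).1.
lia.
Qed.

End Uncovered.

(** * Successive exposure of independent trials *)

Section Exposure.
Variables (I J : finType) (lam : J -> seq I) (s p' q' : nat).
Let p := p'.+1.
Hypothesis q_def : q'.+1 = (4 * p)%N.
Hypothesis size_lam : forall j, (size (lam j) <= s)%N.
Hypothesis few_lists : (32 * #|J| <= #|I|)%N.
Hypothesis I_gt0 : (0 < #|I|)%N.
Local Notation T := 'I_q'.+1.
Let x : rat := 1 - q'.+1%:R^-1.

Let x0 : 0 <= x. Proof. exact: miss_prob_ge0. Qed.
Let x1 : x <= 1. Proof. exact: miss_prob_le1. Qed.

Let F01 n : 0 <= 1 - x ^+ n <= 1.
Proof. by rewrite subr_ge0 exprn_ile1//= gerBl exprn_ge0. Qed.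

(** By [Pr_hits], a lower bound for the probability that edges outside [Z] hit all the segments
    preceding [v]. *)
Let weight Z v := \prod_(j | v \in lam j) (1 - x ^+ #|before v (lam j) :\: Z|).

(* Along one list the exponents are pairwise distinct, so that Euler's product
   bounds the product of its factors; a light point exists by averaging. *)
Lemma exists_light (Z : {set I}) : (8 * #|Z| <= #|I|)%N ->
  exists2 v, v \in candidates lam s Z & 2^-1 ^+ p <= weight Z v.
Proof.
move=> Zs; have cC := card_candidates size_lam Z.
set C := candidates lam s Z in cC *.
have C16 : (16 * #|J| < #|C|)%N by lia.
apply/exists_inP; apply: contraT => /exists_inPn small; exfalso.
have upper : \prod_(v in C) weight Z v <= (2^-1 ^+ p) ^+ #|C|.
  rewrite -prodr_const; apply: ler_prod => v vC.
  rewrite (@ltW _ _ (weight Z v)) ?andbT; last by rewrite ltNge; exact: small.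
  by apply: prodr_ge0 => j _; case/andP: (F01 #|before v (lam j) :\: Z|).
have lower : (16^-1 ^+ q'.+1) ^+ #|J| <= \prod_(v in C) weight Z v.
  rewrite (exchange_big_dep xpredT)//= -[X in X <= _]prodr_const.
  apply: ler_prod => j _; rewrite exprn_ge0 ?invr_ge0 ?ler0n//=.
  (* The exponents lie between 1 and s - 1: candidates exclude 0, and fewer than s points precede a
     member of a list. *)
  apply: le_trans (euler_prod rat q' s.-1) _.
  pose A := [seq v <- enum C | v \in lam j].
  have memA v : (v \in A) = (v \in lam j) && (v \in C) by rewrite mem_filter mem_enum.
  rewrite -(big_mkord xpredT (fun k => 1 - x ^+ k.+1)).
  have -> : \prod_(0 <= k < s.-1) (1 - x ^+ k.+1) = \prod_(k <- iota 1 s.-1) (1 - x ^+ k).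
    by rewrite (iotaDl 1 0) big_map /index_iota subn0.
  rewrite -big_enum_cond -[X in _ <= X]big_filter -/A.
  have -> : \prod_(v <- A) (1 - x ^+ #|before v (lam j) :\: Z|) =
      \prod_(k <- [seq #|before v (lam j) :\: Z| | v <- A]) (1 - x ^+ k).
    by rewrite big_map.
  apply: prod_uniq_sub => //; last exact: iota_uniq.
    rewrite map_inj_in_uniq; first exact/filter_uniq/enum_uniq.
    move=> v w.
    rewrite !memA !inE => /and4P[vl vZ _ _] /and4P[wl wZ _ _].
    by apply: (@card_before_inj _ _ lam Z j); rewrite ?inE ?vl ?wl.
  move=> k /mapP[v]; rewrite memA !inE => /and4P[vl vZ _ /forallP/(_ j)].
  rewrite vl /= => u0 ->; rewrite mem_iota u0 /=.
  by have := card_before_lt size_lam Z vl; lia.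
(* As q = 4p, the two bounds compare 2^(-16p#|J|) with 2^(-p#|C|), which contradicts [C16]. *)
have := le_trans lower upper; rewrite -!exprM.
have -> : 16^-1 = 2^-1 ^+ 4 :> rat by [].
rewrite -exprM ler_iXn2l ?invr_gt0//.
rewrite q_def; nia.
Qed.

(** A non-edge [v] such that every list through [v] meets an edge before reaching [v]; such an edge
    prevents the order behind the list from covering [v]. *)
Definition uncovered (f : {ffun I -> T}) v :=
  (f v != ord0) && [forall j, (v \in lam j) ==> (f \in hit q' (before v (lam j)))].

(** Asking for hits outside [Z] is more than [uncovered] needs, but makes the event independent of
    the variables in [Z] when [v] is a candidate. *)
Definition step_event Z v : {set {ffun I -> T}} :=
  ~: hit q' [set v] :&: \bigcap_(j | v \in lam j) hit q' (before v (lam j) :\: Z).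

Definition step_support Z v : {set I} :=
  v |: \bigcup_(j | v \in lam j) (before v (lam j) :\: Z).

Lemma step_event_uncovered Z v f : f \in step_event Z v -> uncovered f v.
Proof.
rewrite !inE => /andP[/existsPn/(_ v)]; rewrite set11 /= /uncovered => -> /bigcapP H.
apply/forallP => j; apply/implyP => vl; have := H _ vl; rewrite !inE.
move=> /existsP[w /andP[]]; rewrite inE => /andP[_ wb] fw.
by apply/existsP; exists w; rewrite wb.
Qed.

Lemma card_step_support Z v : v \in candidates lam s Z ->
  (#|step_support Z v| <= s ^ 2 + 1)%N.
Proof.
rewrite inE => /and3P[_ dv _]; rewrite addn1.
apply: leq_trans (leq_card_setU _ _).1 _; rewrite cards1 ltnS.
apply: (@leq_trans (\sum_(j | v \in lam j) s)); last first.
  by rewrite sum_nat_const -mulnn leq_mul2r -[X in (X <= _)%N]cardsE dv orbT.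
elim/big_rec2: _ => [|j n T vl IH]; first by rewrite cards0.
by apply: leq_trans (leq_card_setU _ _).1 _; rewrite leq_add// ltnW// card_before_lt.
Qed.

Lemma depends_on_step Z v :
  depends_on (step_event Z v) (step_support Z v).
Proof.
apply: depends_onI.
  apply/depends_onC/depends_onS/depends_on_hit.
  by rewrite sub1set setU11.
elim/big_rec: _ => [|j A vl IH]; first by move=> f g _; rewrite !inE.
apply: depends_onI => //; apply/depends_onS/depends_on_hit.
apply/subsetP => w wb; rewrite inE; apply/orP; right.
by apply/bigcupP; exists j.
Qed.

Lemma disjoint_step_support (Z : {set I}) v : v \notin Z -> [disjoint step_support Z v & Z].
Proof.
move=> vZ; rewrite -setI_eq0; apply/eqP/setP => w; rewrite !inE.
case: (boolP (w \in Z)) => wZ; rewrite ?andbF//= andbT.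
apply/negbTE; rewrite negb_or; apply/andP; split.
  by apply: contra vZ => /eqP <-.
by apply/bigcupP => -[j _]; rewrite !inE wZ.
Qed.

(** The additional factor 1/2 pays for [v] being a non-edge, of probability 1 - 1/q, at least 3/4.
    This is independent of the hits because [v] does not precede itself. *)
Lemma Pr_step Z v : 2^-1 ^+ p <= weight Z v -> 2^-1 ^+ p.+1 <= Pr (step_event Z v).
Proof.
move=> vw; rewrite /step_event (@Pr_indep _ _ _ _ _ [set v]); first last.
- elim/big_rec: _ => [|j A vl IH]; first by move=> f g _; rewrite !inE.
  apply: depends_onI => //; apply/depends_onS/depends_on_hit.
  apply/subsetP => w; rewrite !inE => /andP[_]; apply: contraTneq => ->.
  by have := notin_before v (lam j); rewrite inE.
- apply/depends_onC/depends_on_hit.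
- by rewrite card_ord.
rewrite exprS Pr_miss cards1 expr1 ler_pM ?exprn_ge0//.
  rewrite q_def; have : 1 <= p%:R :> rat by rewrite ler1n.
  rewrite natrM => p1.
  have : (4%:R * p%:R)^-1 <= 4^-1 :> rat by rewrite lef_pV2 ?posrE//; lra.
  lra.
apply: le_trans vw _.
have := Pr_hits q' [seq before v (lam j) :\: Z | j <- enum J & v \in lam j].
by rewrite !big_map !big_filter !big_enum_cond.
Qed.

(** [Q] is the event that [M] successive trials all fail. The points tried and the set [Z] are
    chosen without looking at [f]; each new trial depends only on variables outside the current [Z],
    so that the failure probabilities multiply. *)
Lemma exposure M : (8 * (M * (s ^ 2 + 1)) <= #|I|)%N ->
  exists (Z : {set I}) (Q : {set {ffun I -> T}}),
  [/\ (#|Z| <= M * (s ^ 2 + 1))%N, depends_on Q Z,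
      Pr Q <= (1 - 2^-1 ^+ p.+1) ^+ M &
      forall f, (forall v, ~~ uncovered f v) -> f \in Q].
Proof.
elim: M => [|M IH] M8.
  exists set0, setT; split=> //; first by rewrite cards0.
    by move=> f g _; rewrite !inE.
    by rewrite expr0 Pr_le1// card_ord.
  by move=> f _; rewrite inE.
have [|Z [Q [cZ dQ PQ QH]]] := IH; first by lia.
have [|v vC vw] := @exists_light Z.
  by lia.
have vZ : v \notin Z by move: vC; rewrite inE => /and3P[].
exists (step_support Z v :|: Z), (~: step_event Z v :&: Q); split.
- apply: leq_trans (leq_card_setU _ _).1 _.
  by rewrite mulSn leq_add// card_step_support.
- apply: depends_onI.
    by apply/depends_onC/(depends_onS _ (@depends_on_step Z v))/subsetUl.
  exact: depends_onS (subsetUr _ _) dQ.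
- rewrite (@Pr_indep _ _ _ _ _ (step_support Z v)).
  + rewrite exprS; apply: ler_pM; rewrite ?Pr_ge0//.
    by rewrite PrC ?card_ord// lerB// Pr_step.
  + by rewrite card_ord.
  + exact/depends_onC/depends_on_step.
  + apply: depends_onS dQ; rewrite -disjoints_subset disjoint_sym.
    exact: disjoint_step_support.
move=> f nf; rewrite inE QH// andbT inE.
by apply: contra (nf v); apply: step_event_uncovered.
Qed.

End Exposure.

(** * Covering the non-edges of a random bipartite graph *)

(** This is the source of the threshold 21: 200 * 21^3 = 1852200 is below 2^21 = 2097152. *)
Lemma cube_le_exp2 p : (21 <= p)%N -> (200 * p ^ 3 <= 2 ^ p)%N.
Proof.
move=> /subnK <-; elim: (p - 21)%N => [|m]; first by lia.
rewrite addSn [(2 ^ _.+1)%N]expnS; move: (m + 21)%N (leq_addl m 21) => a a21.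
have le3 : (a.+1 ^ 3 <= 2 * a ^ 3)%N by rewrite !expnS !expn0; nia.
by move=> le; lia.
Qed.

Lemma expr_half_le m : (1 - 2^-1 ^+ m) ^+ (2 ^ m) <= 2^-1 :> rat.
Proof.
have := expr_le_half rat (2 ^ m).-1.
by rewrite prednK ?expn_gt0// natrX exprVn.
Qed.

Lemma exp2_small (F : realFieldType) a b :
  (a + 2 <= b)%N -> (2 ^ a)%:R * 2^-1 ^+ b <= 4^-1 :> F.
Proof.
move=> /subnKC <-; rewrite natrX !exprD mulrA mulrA -exprMn divff ?pnatr_eq0// expr1n mul1r.
have -> : 2^-1 ^+ 2 = 4^-1 :> F by rewrite expr2; lra.
by rewrite ler_piMr ?invr_ge0// exprn_ile1 ?invr_ge0//; lra.
Qed.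

(** An arbitrary order type allows the use of the dual order, which provides the largest
    elements. *)
Lemma sorted_prefix d (R : orderType d) (n s : nat) (r : 'I_n -> R) : (s <= n)%N ->
  exists t : s.-tuple 'I_n, [/\ uniq t,
    {in t, forall a a', a' \in before a t -> r a' <= r a}%O &
    forall a a', a \notin t -> a' \in t -> (r a' <= r a)%O].
Proof.
move=> sn; pose le := relpre r (@Order.le d R).
have letot : total le by move=> a b; apply: le_total.
have letr : transitive le by move=> b a c; apply: le_trans.
pose L := sort le (enum 'I_n).
have sL : sorted le L by apply: sort_sorted.
have uL : uniq L by rewrite sort_uniq enum_uniq.
have mL a : a \in L by rewrite mem_sort mem_enum.
have szt : size (take s L) == s.
  by rewrite size_takel// size_sort size_enum_ord.
exists (Tuple szt); split => [|a at_ a'|a a' at_ a't].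
- by rewrite take_uniq.
- rewrite inE in_take_leq ?index_size// => lt.
  have a't : a' \in take s L by rewrite -index_mem (leq_trans lt)// index_size.
  exact: (sorted_ltn_index letr (take_sorted s sL)) lt.
rewrite /= !in_take_leq ?size_sort ?size_enum_ord// -?leqNgt in at_ a't.
by apply: (sorted_ltn_index letr sL) => //; apply: leq_trans a't at_.
Qed.

Section Covering.
Variables (n k s : nat).
Local Notation I := ('I_n * 'I_n)%type.
Local Notation J := ('I_k * 'I_n + 'I_k * 'I_n)%type.
Local Notation orders := {ffun 'I_k -> s.-tuple 'I_n}.

(** Each coordinate yields one list per column and one per row of the grid of pairs. Truncating the
    orders to [s] elements is what makes the configurations few enough for a union bound. *)
Definition lines (c : orders * orders) (j : J) : seq I :=
  match j with
  | inl ib => [seq (a, ib.2) | a <- c.1 ib.1]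
  | inr ia => [seq (ia.2, b) | b <- c.2 ia.1]
  end.

Lemma size_lines c j : (size (lines c j) <= s)%N.
Proof. by case: j => [] [i z]; rewrite size_map size_tuple. Qed.

Lemma before_map (T1 T2 : finType) (h : T1 -> T2) (v : T1) (l : seq T1) w :
  injective h -> h w \in before (h v) [seq h z | z <- l] -> w \in before v l.
Proof.
by move=> hinj; rewrite !inE index_map// -map_take mem_map.
Qed.

Lemma lists_few : (64 * k <= n)%N -> (32 * #|{: J}| <= #|{: I}|)%N.
Proof. by rewrite card_sum !card_prod !card_ord; nia. Qed.

Variable q' : nat.
Local Notation T := 'I_q'.+1.

Definition rectangle (t : s.-tuple 'I_n * s.-tuple 'I_n) : {set I} :=
  setX [set a in t.1] [set b in t.2].

(** Suppose that coordinate i covers the uncovered pair (a, b). If a or b is among the first [s]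
    elements of its order, an edge precedes (a, b) on the corresponding line; otherwise the
    rectangle of first elements contains an edge. By monotonicity that edge satisfies r < l too,
    contrary to the separation hypothesis. *)
Lemma exists_uncovered_pair d (R : orderType d) (r l : 'I_k -> 'I_n -> R)
    (f : {ffun I -> T}) :
  (s <= n)%N ->
  (forall c, exists v, uncovered (lines c) f v) ->
  (forall t : s.-tuple 'I_n * s.-tuple 'I_n, uniq t.1 -> uniq t.2 -> f \in hit q' (rectangle t)) ->
  (forall i a b, r i a < l i b -> f (a, b) != ord0)%O ->
  exists a b, f (a, b) != ord0 /\ forall i, ~~ (r i a < l i b)%O.
Proof.
move=> sn cov rect sep.
pose P (i : 'I_k) (t : s.-tuple 'I_n) := [/\ uniq t,
    {in t, forall a a', a' \in before a t -> r i a' <= r i a}%O &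
    forall a a', a \notin t -> a' \in t -> (r i a' <= r i a)%O].
pose P' (i : 'I_k) (t : s.-tuple 'I_n) := [/\ uniq t,
    {in t, forall b b', b' \in before b t -> l i b <= l i b'}%O &
    forall b b', b \notin t -> b' \in t -> (l i b <= l i b')%O].
have /fin_all_exists[c1 Pc1] : forall i, exists t, P i t.
  by move=> i; apply: sorted_prefix.
(* On the right side large values of [l i] come first. *)
have /fin_all_exists[c2 Pc2] : forall i, exists t, P' i t.
  by move=> i; apply: (@sorted_prefix _ R^d).
have [[a b]] := cov ([ffun i => c1 i], [ffun i => c2 i]).
move=> /andP[fab /forallP H]; exists a, b; split=> // i; apply/negP => ltab.
have [u1 o1 m1] := Pc1 i; have [u2 o2 m2] := Pc2 i.
have [ac|ac] := boolP (a \in c1 i).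
  have := H (inl (i, b)); rewrite /= ffunE map_f//= inE.
  move=> /existsP[[a' b'] /andP[wb /eqP f0]].
  have /mapP[a'' _ [? Eb]] : (a', b') \in [seq (z, b) | z <- c1 i].
    by move: wb; rewrite inE => /mem_take.
  subst b'; have /o1 : a' \in before a (c1 i).
    by apply: (@before_map _ _ (fun z => (z, b))) wb => z z' [].
  by move=> /(_ ac) le; have := sep i a' b (le_lt_trans le ltab); rewrite f0 eqxx.
have [bc|bc] := boolP (b \in c2 i).
  have := H (inr (i, a)); rewrite /= ffunE map_f//= inE.
  move=> /existsP[[a' b'] /andP[wb /eqP f0]].
  have /mapP[b'' _ [Ea ?]] : (a', b') \in [seq (a, z) | z <- c2 i].
    by move: wb; rewrite inE => /mem_take.
  subst a'; have /o2 : b' \in before b (c2 i).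
    by apply: (@before_map _ _ (fun z => (a, z))) wb => z z' [].
  by move=> /(_ bc) le; have := sep i a b' (lt_le_trans ltab le); rewrite f0 eqxx.
have := rect (c1 i, c2 i) u1 u2; rewrite inE => /existsP[[a' b'] /andP[]].
rewrite !inE /= => /andP[a'c b'c] /eqP f0.
have /sep : (r i a' < l i b')%O.
  exact: le_lt_trans (m1 _ _ ac a'c) (lt_le_trans ltab (m2 _ _ bc b'c)).
by rewrite f0 eqxx.
Qed.

End Covering.

Lemma card_hit1 (I : finType) q' (v : I) :
  #|hit q' [set v]|%:R = q'.+1%:R^-1 * #|{ffun I -> 'I_q'.+1}|%:R :> rat.
Proof.
have T0 : (0 < #|'I_q'.+1|)%N by rewrite card_ord.
have := Pr_miss q' [set v]; rewrite cards1 expr1 PrC//.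
rewrite /Pr => /(congr1 (fun z => 1 - z)); rewrite !subKr => <-.
by rewrite divfK// pnatr_eq0 -lt0n card_ffun_gt0.
Qed.

(** Three bad events have probability at most 1/4 each: a configuration without uncovered pair, an
    empty s x s rectangle, and more than n^2/p edges. *)
Lemma random_bipartite (p k : nat) : (21 <= p)%N -> (64 * k <= 16 ^ p)%N ->
  exists E : {set 'I_(16 ^ p) * 'I_(16 ^ p)},
    (p * #|E| <= (16 ^ p) ^ 2)%N /\
    forall d (R : orderType d) (r l : 'I_k -> 'I_(16 ^ p) -> R),
    (forall i a b, r i a < l i b -> (a, b) \notin E)%O ->
    exists a b, (a, b) \notin E /\ forall i, ~~ (r i a < l i b)%O.
Proof.
set n := (16 ^ p)%N => p21 k64.
have n2p : n = (2 ^ (4 * p))%N by rewrite /n expnM.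
pose p' := p.-1; have pE : p'.+1 = p by rewrite /p'; lia.
pose q' := (4 * p).-1; have qE : q'.+1 = (4 * p)%N by rewrite /q'; lia.
(* With q = 4p, n = 2^q and s^2 = q * 9q^3, a given rectangle is empty with probability at most
   2^(-9q^3), against n^(2s) = 2^(6q^3) pairs of tuples. *)
pose s := (3 * (4 * p) ^ 2)%N.
have cube := cube_le_exp2 p21.
have n4 : n = ((2 ^ p) ^ 4)%N by rewrite n2p mulnC expnM.
have sn : (s <= n)%N.
  rewrite n4; apply: (@leq_trans (2 ^ p)%N).
    by apply: leq_trans cube; rewrite /s !expnS !expn0; nia.
  by rewrite -[X in (X <= _)%N]expn1 leq_pexp2l// expn_gt0.
pose I := ('I_n * 'I_n)%type; have cI : #|{: I}| = (n ^ 2)%N by rewrite card_prod card_ord.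
pose T := 'I_q'.+1; have T0 : (0 < #|{: T}|)%N by rewrite card_ord.
pose cfg := ({ffun 'I_k -> s.-tuple 'I_n} * {ffun 'I_k -> s.-tuple 'I_n})%type.
(* Small enough for [M] supports of size s^2 + 1 to fill at most an eighth of the n^2 = 2^(8p)
   pairs, large enough for the union bound over configurations. *)
pose M := (2 ^ (6 * p))%N.
have M8 : (8 * (M * (s ^ 2 + 1)) <= #|{: I}|)%N.
  rewrite cI n4 /M; have -> : (2 ^ (6 * p) = (2 ^ p) ^ 6)%N by rewrite mulnC expnM.
  rewrite /s; move: (2 ^ p)%N cube => e cube.
  have : (8 * ((3 * (4 * p) ^ 2) ^ 2 + 1) <= e ^ 2)%N.
    apply: leq_trans (leq_mul cube cube); rewrite !expnS !expn0; nia.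
  move: (_ + 1)%N => w /(leq_mul (leqnn (e ^ 6)%N)); rewrite -expnD -expnM.
  by rewrite mulnCA mulnA.
pose bad1 := \bigcup_(c : cfg) [set f : {ffun I -> T} | [forall v, ~~ uncovered (lines c) f v]].
pose bad2 := \bigcup_(t : s.-tuple 'I_n * s.-tuple 'I_n)
  if uniq t.1 && uniq t.2 then ~: hit q' (rectangle t) else set0.
pose E (f : {ffun I -> T}) := [set v | f v == ord0].
pose bad3 := [set f : {ffun I -> T} | (n ^ 2 < p * #|E f|)%N].
have Pr1 : Pr bad1 <= 4^-1.
  have each (c : cfg) : Pr [set f : {ffun I -> T} | [forall v, ~~ uncovered (lines c) f v]]
      <= 2^-1 ^+ (2 ^ (5 * p).-1).
    have [|||||Z [Q [_ _ PQ QH]]] := @exposure _ _ (lines c) s p' q' _ _ _ _ M.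
    - by rewrite qE pE.
    - exact: size_lines.
    - exact: lists_few.
    - by rewrite cI expn_gt0 n4 !expn_gt0.
    - exact: M8.
    apply: (@le_trans _ _ (Pr Q)).
      by apply/Pr_le/subsetP => f; rewrite inE => /forallP/QH.
    apply: le_trans PQ _; rewrite pE.
    (* Each group of 2^(p+1) trials fails with probability at most 1/2. *)
    have -> : M = (2 ^ p.+1 * 2 ^ (5 * p).-1)%N by rewrite /M -expnD; congr expn; lia.
    rewrite exprM lerXn2r ?nnegrE ?expr_half_le ?invr_ge0 ?ler0n//.
    by rewrite exprn_ge0// subr_ge0 exprn_ile1//; lra.
  apply: le_trans (Pr_bigcup each) _.
  rewrite card_prod card_ffun card_tuple !card_ord mulnn n2p -!expnM.
  apply: exp2_small.
  have -> : (2 ^ (5 * p).-1 = 2 ^ p.-1 * 2 ^ (4 * p))%N by rewrite -expnD; congr expn; lia.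
  have : (100 * p ^ 3 <= 2 ^ p.-1)%N.
    have E2 : (2 ^ p = 2 * 2 ^ p.-1)%N by rewrite -expnS; congr expn; lia.
    by move: cube; rewrite E2; lia.
  rewrite -n2p; move: (2 ^ p.-1)%N => e le.
  have -> : (4 * p * (s * (k * 2)) = 6 * p ^ 3 * (64 * k))%N by rewrite /s; ring.
  have : (6 * p ^ 3 * (64 * k) <= 6 * p ^ 3 * n)%N by rewrite leq_mul2l k64 orbT.
  have : (100 * p ^ 3 * n <= e * n)%N by rewrite leq_mul2r le orbT.
  have : (1 <= p ^ 3)%N by rewrite expn_gt0; lia.
  have : (1 <= n)%N by rewrite n4 !expn_gt0.
  move: (p ^ 3)%N => w; nia.
have Pr2 : Pr bad2 <= 4^-1.
  have each (t : s.-tuple 'I_n * s.-tuple 'I_n) :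
      Pr (if uniq t.1 && uniq t.2 then ~: hit q' (rectangle t) else set0)
      <= 2^-1 ^+ (9 * (4 * p) ^ 3).
    case: ifP => [/andP[u1 u2]|_]; last by rewrite /Pr cards0 mul0r exprn_ge0.
    rewrite Pr_miss cardsX !cardsE (card_uniqP u1) (card_uniqP u2) !size_tuple.
    have -> : (s * s = q'.+1 * (9 * (4 * p) ^ 3))%N by rewrite qE /s; ring.
    by rewrite exprM lerXn2r ?nnegrE ?expr_le_half ?invr_ge0 ?ler0n// exprn_ge0// miss_prob_ge0.
  apply: le_trans (Pr_bigcup each) _.
  rewrite card_prod card_tuple card_ord mulnn n2p -!expnM.
  apply: exp2_small.
  have -> : (4 * p * (s * 2) = 6 * (4 * p) ^ 3)%N by rewrite /s; ring.
  have : (1 <= (4 * p) ^ 3)%N by rewrite expn_gt0; lia.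
  move: ((4 * p) ^ 3)%N; lia.
have Pr3 : Pr bad3 <= 4^-1.
  (* Markov's inequality by counting: the mean number of edges is n^2/(4p), a quarter of the number
     allowed. *)
  have EW : (\sum_(f : {ffun I -> T}) #|E f| = \sum_(v : I) #|hit q' [set v]|)%N.
    under eq_bigr do rewrite -sum1dep_card.
    rewrite (exchange_big_dep xpredT)//=; apply: eq_bigr => v _.
    rewrite sum1dep_card; apply: eq_card => f; rewrite !inE.
    apply/idP/existsP => [f0|[w]]; first by exists v; rewrite set11.
    by rewrite inE => /andP[/eqP ->].
  have Eh (v : I) : #|hit q' [set v]|%:R = (4 * p)%:R^-1 * #|{ffun I -> T}|%:R :> rat.
    by rewrite -qE; exact: card_hit1.
  have : (#|bad3| * n ^ 2 <= p * \sum_(f : {ffun I -> T}) #|E f|)%N.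
    rewrite big_distrr /= -sum_nat_const [X in (_ <= X)%N](bigID (mem bad3)) /=.
    apply: leq_trans (leq_addr _ _); apply: leq_sum => f; rewrite inE; exact: ltnW.
  rewrite EW -(ler_nat rat) [(#|bad3| * _)%:R]natrM [(p * _)%:R]natrM natr_sum (eq_bigr _ (fun v _ => Eh v)).
  rewrite sumr_const cI -[(_ * _) *+ _]mulr_natl [(4 * p)%:R]natrM.
  have N0 : 0 < #|{ffun I -> T}|%:R :> rat by rewrite ltr0n card_ffun_gt0.
  have n0 : 0 < (n ^ 2)%:R :> rat by rewrite ltr0n n4 !expn_gt0.
  have p0 : 0 < p%:R :> rat by rewrite ltr0n; lia.
  rewrite /Pr ler_pdivrMr//; move: n0 N0 p0.
  set a := (n ^ 2)%:R; set b := #|{ffun I -> T}|%:R; set c := #|bad3|%:R; set P := p%:R.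
  move=> a0 b0 P0; have -> : P * (a * ((4 * P)^-1 * b)) = (4^-1 * b) * a.
    by field; rewrite gt_eqF.
  by rewrite ler_pM2r.
have /subsetPn[f _] : ~~ ([set: {ffun I -> T}] \subset bad1 :|: bad2 :|: bad3).
  apply/negP => /Pr_le; rewrite PrT//.
  have := Pr_setU (bad1 :|: bad2) bad3; have := Pr_setU bad1 bad2; lra.
rewrite !inE !negb_or => /andP[/andP[f1 f2] f3].
exists (E f); split; first by rewrite leqNgt.
move=> d R r l sep.
have [|||a [b [fab H]]] := @exists_uncovered_pair n k s q' d R r l f sn.
- move=> c; apply/existsP; apply: contraR f1 => /existsPn H.
  by apply/bigcupP; exists c => //; rewrite inE; apply/forallP.
- move=> t u1 u2; apply: contraR f2 => H.
  by apply/bigcupP; exists t => //; rewrite u1 u2 inE.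
- by move=> i a b /sep; rewrite inE.
by exists a, b; split; rewrite ?inE.
Qed.

(** * Every drawing of the complete graph on five vertices has a crossing *)

Section RayCrossings.
Variable R : realDomainType.
Implicit Types p z : R * R.

Definition lexlt p z := (p.2 < z.2) || ((p.2 == z.2) && (p.1 < z.1)).

Lemma lexlt_asym p z : p != z -> lexlt z p = ~~ lexlt p z.
Proof.
case: p z => [p1 p2] [z1 z2]; rewrite /lexlt xpair_eqE /=.
by case: (ltgtP p2 z2) => //= _; case: (ltgtP p1 z1).
Qed.

(* Whether the step from [z] to [z'] crosses the horizontal ray issued from [p]
   to the right; only meaningful when the step is short compared with its
   distance to [p]. The total preorder by ordinates is refined to [lexlt] so
   that exchanging the roles of [p] and [z] negates the comparison. *)
Definition ray_cross p z z' := (lexlt p z (+) lexlt p z') && (p.1 < z.1).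

Definition coord_close (e : R) z z' := (`|z.1 - z'.1| < e) && (`|z.2 - z'.2| < e).
Definition coord_far (e : R) z z' := (e <= `|z.1 - z'.1|) || (e <= `|z.2 - z'.2|).

(** A step from b to b' that changes sides of the level of a passes either to the right or to the
    left of a. Equal abscissas of a and b are excluded, since a vertical gap of 2e would leave no
    room to change sides. *)
Lemma ray_cross_swap e a b b' : coord_close e b b' -> coord_far (2 * e) a b ->
  ray_cross a b b' (+) lexlt b a (+) lexlt b' a =
  (lexlt b a (+) lexlt b' a) && (b.1 < a.1).
Proof.
case: a b b' => [a1 a2] [b1 b2] [b1' b2'].
rewrite /coord_close /coord_far /= !real_ltr_norml ?num_real// !real_ler_normr ?num_real//.
move=> /andP[/andP[h1 h2] /andP[h3 h4]] H.
rewrite /ray_cross (@lexlt_asym (b1, b2)); last first.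
  by rewrite xpair_eqE; case: eqP => //= E1; case: eqP => //= E2; case: H => /orP[/orP[]|/orP[]]; lra.
rewrite (@lexlt_asym (b1', b2')); last first.
  by rewrite xpair_eqE; case: eqP => //= E1; case: eqP => //= E2; case: H => /orP[/orP[]|/orP[]]; lra.
have [E|NE] := eqVneq (lexlt (b1, b2) (a1, a2)) (lexlt (b1', b2') (a1, a2)).
  by rewrite E; case: (lexlt _ _).
have : a1 != b1.
  apply: contraNneq NE => E; rewrite /lexlt /=.
  have [?|?] : b2 + 2 * e <= a2 \/ a2 + 2 * e <= b2 by case/orP: H => /orP[]; lra.
    have -> : b2 < a2 by lra.
    by have -> : b2' < a2 by lra.
  have -> : (b2 < a2) = false by lra.
  have -> : (b2' < a2) = false by lra.
  have -> : (b2 == a2) = false by lra.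
  by have -> : (b2' == a2) = false by lra.
move: NE; case: (lexlt _ _); case: (lexlt _ _) => //= _; by case: ltgtP.
Qed.

(** One coordinate separates both a, a' from both b, b'. If it is the abscissa, all the conditions
    on abscissas agree and the comparisons cancel; if it is the ordinate, all comparisons agree. *)
Lemma ray_cross_cell e a a' b b' :
  coord_close e a a' -> coord_close e b b' -> coord_far (3 * e) a b ->
  let v z := (lexlt b z (+) lexlt b' z) && (b.1 < z.1) in
  (ray_cross b a a' (+) ray_cross b' a a') (+) (v a (+) v a') = false.
Proof.
case: a a' b b' => [a1 a2] [a1' a2'] [b1 b2] [b1' b2'].
rewrite /coord_close /coord_far /ray_cross /= !real_ltr_norml ?num_real// !real_ler_normr ?num_real//.
move=> /andP[/andP[h1 h2] /andP[h3 h4]] /andP[/andP[h1' h2'] /andP[h3' h4']].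
case/orP => /orP[] h.
- have -> : b1 < a1 by lra.
  have -> : b1 < a1' by lra.
  have -> : b1' < a1 by lra.
  by rewrite !andbT; do 4!case: (lexlt _ _).
- have -> : (b1 < a1) = false by lra.
  have -> : (b1 < a1') = false by lra.
  have -> : (b1' < a1) = false by lra.
  by rewrite !andbF.
- rewrite /lexlt /=.
  have -> : b2 < a2 by lra.
  have -> : b2 < a2' by lra.
  have -> : b2' < a2 by lra.
  by have -> : b2' < a2' by lra.
rewrite /lexlt /=.
have -> : (b2 < a2) = false by lra.
have -> : (b2 < a2') = false by lra.
have -> : (b2' < a2) = false by lra.
have -> : (b2' < a2') = false by lra.
have -> : (b2 == a2) = false by lra.
have -> : (b2 == a2') = false by lra.
have -> : (b2' == a2) = false by lra.
by have -> : (b2' == a2') = false by lra.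
Qed.

Lemma addb_telescope (f : nat -> bool) m :
  \big[addb/false]_(i < m) (f i (+) f i.+1) = f 0%N (+) f m.
Proof.
elim: m => [|m IH]; first by rewrite big_ord0 addbb.
by rewrite big_ord_recr /= IH addbA addbK.
Qed.

(** A discrete Green formula over F_2: summing over the cells, the inner sides cancel and only the
    boundary of the square remains. *)
Lemma addb_grid (h v : nat -> nat -> bool) m :
  (forall i j, (i < m)%N -> (j < m)%N ->
    (h i j (+) h i j.+1) (+) (v i j (+) v i.+1 j) = false) ->
  \big[addb/false]_(i < m) h i 0%N (+) \big[addb/false]_(i < m) h i m =
  \big[addb/false]_(j < m) v 0%N j (+) \big[addb/false]_(j < m) v m j.
Proof.
move=> cell; have addb_eq x y : x (+) y = false -> x = y by case: x y => [] [].
apply: addb_eq.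
have := addb_telescope (fun j => \big[addb/false]_(i < m) h i j) m => /= <-.
have := addb_telescope (fun i => \big[addb/false]_(j < m) v i j) m => /= <-.
under eq_bigr do rewrite -big_split.
under [X in _ (+) X]eq_bigr do rewrite -big_split.
rewrite exchange_big -big_split big1// => i _.
by rewrite -big_split big1// => j _; apply: cell.
Qed.

Definition ray_parity p (c : nat -> R * R) m :=
  \big[addb/false]_(i < m) ray_cross p (c i) (c i.+1).

(* The grid cells are small compared with the distance between the two paths,
   so the parity along the boundary of the square vanishes. *)
Lemma ray_parity_square e (a b : nat -> R * R) m :
  (forall i, (i < m)%N -> coord_close e (a i) (a i.+1)) ->
  (forall j, (j < m)%N -> coord_close e (b j) (b j.+1)) ->
  (forall i j, (i <= m)%N -> (j <= m)%N -> coord_far (3 * e) (a i) (b j)) ->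
  ray_parity (b 0%N) a m (+) ray_parity (b m) a m (+)
    (ray_parity (a 0%N) b m (+) ray_parity (a m) b m) =
  lexlt (b 0%N) (a 0%N) (+) lexlt (b m) (a 0%N) (+)
    (lexlt (b 0%N) (a m) (+) lexlt (b m) (a m)).
Proof.
move=> ca cb fab.
(* By [ray_cross_swap] the remaining two sides of the square count crossings of [b] with rays issued
   from points of [a], up to comparisons that telescope. *)
have side i : (i <= m)%N ->
    \big[addb/false]_(j < m) ((lexlt (b j) (a i) (+) lexlt (b j.+1) (a i)) && ((b j).1 < (a i).1))
    = ray_parity (a i) b m (+) (lexlt (b 0%N) (a i) (+) lexlt (b m) (a i)).
  move=> im; rewrite -(addb_telescope (fun j => lexlt (b j) (a i))) -big_split.
  apply: eq_bigr => j _.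
  have cbj := cb j (ltn_ord j); have fabj := fab i j im (ltnW (ltn_ord j)).
  rewrite -(ray_cross_swap cbj); first by rewrite -addbA.
  move: cbj fabj; rewrite /coord_close /coord_far => /andP[x0 _].
  have := normr_ge0 ((b j).1 - (b j.+1).1) => y0.
  by case/orP => h; apply/orP; [left|right]; lra.
have cell i j : (i < m)%N -> (j < m)%N ->
    (ray_cross (b j) (a i) (a i.+1) (+) ray_cross (b j.+1) (a i) (a i.+1)) (+)
    ((lexlt (b j) (a i) (+) lexlt (b j.+1) (a i)) && ((b j).1 < (a i).1) (+)
     ((lexlt (b j) (a i.+1) (+) lexlt (b j.+1) (a i.+1)) && ((b j).1 < (a i.+1).1)))
    = false.
  move=> im jm; apply: (@ray_cross_cell e); [exact: ca|exact: cb|].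
  exact: fab (ltnW _) (ltnW _).
have E := @addb_grid (fun i j => ray_cross (b j) (a i) (a i.+1))
  (fun i j => (lexlt (b j) (a i) (+) lexlt (b j.+1) (a i)) && ((b j).1 < (a i).1)) m cell.
rewrite !side// -/(ray_parity (b 0%N) a m) -/(ray_parity (b m) a m) in E.
rewrite E; do 2!case: (ray_parity _ _ _); by do 4!case: (lexlt _ _).
Qed.

End RayCrossings.

(** Turns a relation over F_2 into an integer equation, so that [lia] can add up such relations. *)
Lemma addb_parity (a b c d e f g h : bool) :
  a (+) b (+) (c (+) d) = e (+) f (+) (g (+) h) ->
  exists z : nat, (a + b + c + d + e + f + g + h = z.*2)%N.
Proof.
move=> E; exists (a + b + c + d + e + f + g + h)./2%N.
rewrite halfK; have : odd (a + b + c + d + e + f + g + h) = false.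
  by rewrite !oddD !oddb; move: E; case: a; case: b; case: c; case: d; case: e; case: f; case: g; case: h.
by move=> ->; rewrite subn0.
Qed.

(* Summing the relation over the 15 pairs of disjoint edges of K_5, every [K]
   occurs twice while the comparisons contribute an odd number. *)
Lemma K5_parity (K : nat -> nat -> nat -> bool) (s : nat -> nat -> bool) :
  (forall i j, (i < j < 5)%N -> s j i = ~~ s i j) ->
  ~ forall i j k l, (i < j < 5)%N -> (k < l < 5)%N ->
    [&& i != k, i != l, j != k & j != l] ->
    K i j k (+) K i j l (+) (K k l i (+) K k l j) =
    s i k (+) s i l (+) (s j k (+) s j l).
Proof.
move=> sN H.
have P i j k l h1 h2 h3 := addb_parity (H i j k l h1 h2 h3).
have N i j (h : (i < j < 5)%N) : (s j i + s i j = 1)%N.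
  by rewrite (sN i j h); case: (s i j).
have [z1] := P 0%N 1%N 2%N 3%N isT isT isT.
have [z2] := P 0%N 1%N 2%N 4%N isT isT isT.
have [z3] := P 0%N 1%N 3%N 4%N isT isT isT.
have [z4] := P 0%N 2%N 1%N 3%N isT isT isT.
have [z5] := P 0%N 2%N 1%N 4%N isT isT isT.
have [z6] := P 0%N 2%N 3%N 4%N isT isT isT.
have [z7] := P 0%N 3%N 1%N 2%N isT isT isT.
have [z8] := P 0%N 3%N 1%N 4%N isT isT isT.
have [z9] := P 0%N 3%N 2%N 4%N isT isT isT.
have [z10] := P 0%N 4%N 1%N 2%N isT isT isT.
have [z11] := P 0%N 4%N 1%N 3%N isT isT isT.
have [z12] := P 0%N 4%N 2%N 3%N isT isT isT.
have [z13] := P 1%N 2%N 3%N 4%N isT isT isT.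
have [z14] := P 1%N 3%N 2%N 4%N isT isT isT.
have [z15] := P 1%N 4%N 2%N 3%N isT isT isT.
have := N 0%N 1%N isT; have := N 0%N 2%N isT; have := N 0%N 3%N isT.
have := N 0%N 4%N isT; have := N 1%N 2%N isT; have := N 1%N 3%N isT.
have := N 1%N 4%N isT; have := N 2%N 3%N isT; have := N 2%N 4%N isT.
have := N 3%N 4%N isT.
clear; do !(move: (nat_of_bool _) => ?).
lia.
Qed.

From mathcomp Require Import all_classical all_reals all_analysis.
Import Order.TTheory GRing.Theory Num.Theory.

Section Topology.
Import numFieldNormedType.Exports.
Local Open Scope classical_set_scope.
Local Open Scope ring_scope.

(** * Fine sampling of disjoint arcs *)

Section Paths.
Variable R : realType.
Implicit Types (c : R -> R * R).

Lemma near_close c : {within `[0, 1], continuous c} ->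
  forall s : R, s \in `[0, 1] -> forall e : R, 0 < e ->
  \forall x \near s, x \in `[0, 1] -> coord_close e (c s) (c x).
Proof.
move=> /subspace_continuousP cc s s01 e e0.
have /cvg_ballP/(_ e e0) := cc s s01.
move=> H; rewrite near_withinE in H; apply: filterS H => x H x01.
by have [] := H x01; rewrite /coord_close /= => -> ->.
Qed.

Lemma coord_closeC (e : R) (z z' : R * R) : coord_close e z z' = coord_close e z' z.
Proof. by rewrite /coord_close !(distrC z.1) !(distrC z.2). Qed.

Lemma coord_close_trans (e e' : R) (y z z' : R * R) :
  coord_close e z y -> coord_close e' y z' -> coord_close (e + e') z z'.
Proof.
move=> /andP[h1 h2] /andP[h3 h4]; apply/andP; split.
  by apply: le_lt_trans (ler_distD y.1 _ _) _; apply: ltrD.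
by apply: le_lt_trans (ler_distD y.2 _ _) _; apply: ltrD.
Qed.

Lemma coord_far_close (e e' : R) (y z z' : R * R) :
  coord_far (e + e') z y -> coord_close e z z' -> coord_far e' z' y.
Proof.
move=> fzy /andP[h1 h2]; case/orP: fzy => h; apply/orP; [left|right].
  by have := ler_distD z'.1 z.1 y.1; lra.
by have := ler_distD z'.2 z.2 y.2; lra.
Qed.

Lemma coord_far_neq (z z' : R * R) : z != z' -> exists2 e : R, 0 < e & coord_far (e + e) z z'.
Proof.
move=> zz'; have [E|n1] := eqVneq z.1 z'.1.
  have n2 : z.2 != z'.2.
    by apply: contraNneq zz' => E2; case: z z' E E2 => ? ? [? ?] /= -> ->.
  exists (`|z.2 - z'.2| / 2); first by rewrite divr_gt0// normr_gt0 subr_eq0.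
  by apply/orP; right; lra.
exists (`|z.1 - z'.1| / 2); first by rewrite divr_gt0// normr_gt0 subr_eq0.
by apply/orP; left; lra.
Qed.

Lemma coord_far_le (e e' : R) (z z' : R * R) : e <= e' -> coord_far e' z z' -> coord_far e z z'.
Proof. by move=> ee' /orP[] h; apply/orP; [left|right]; lra. Qed.

Lemma near_natSinv (e : R) : 0 < e -> \forall m \near \oo, m.+1%:R^-1 < e.
Proof. by move=> e0; apply: (near_infty_natSinv_lt (PosNum e0)). Qed.

(** Compactness: a threshold for m that is locally uniform in the parameter can be chosen uniformly
    on the segment. *)
Lemma segment_covering (P : nat -> R -> Prop) :
  (forall s : R, s \in `[0, 1] ->
     exists2 e : R, 0 < e & \forall m \near \oo,
       forall x : R, `|s - x| < e -> x \in `[0, 1] -> P m x) ->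
  \forall m \near \oo, forall s, s \in `[0, 1] -> P m s.
Proof.
move=> H; have K : compact `[(0:R), 1] := @segment_compact R 0 1.
move/compact_near_coveringP/near_covering_withinP : K => /(_ nat \oo P _) K.
apply: K => s /H [e e0 Hm]; exists ([set x | `|s - x| < e], [set m | forall x : R, `|s - x| < e -> x \in `[0, 1] -> P m x]) => /=.
  by split=> //; apply/nbhs_ballP; exists e.
by move=> [x m] /= [sx Pm] x01; apply: Pm.
Qed.

Lemma near_step_close c : {within `[0, 1], continuous c} -> forall e : R, 0 < e ->
  \forall m \near \oo, forall s, s \in `[0, 1] -> forall t, t \in `[0, 1] ->
    `|s - t| <= m.+1%:R^-1 -> coord_close e (c s) (c t).
Proof.
move=> cc e e0; apply: segment_covering => s s01.
have e2 : 0 < e / 2 by rewrite divr_gt0.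
have /nbhs_ballP[d /= d0 Hd] := near_close cc s01 e2.
have d2 : 0 < d / 2 by rewrite divr_gt0.
exists (d / 2) => //; apply: filterS (near_natSinv d2) => m md x sx x01 t t01 xt.
have -> : e = e / 2 + e / 2 by lra.
apply: (@coord_close_trans _ _ (c s)).
  have sx' : `|s - x| < d by lra.
  by rewrite coord_closeC; apply: Hd.
have st : `|s - t| < d.
  rewrite [d](_ : _ = d / 2 + d / 2); last by lra.
  apply: le_lt_trans (ler_distD x s t) _; apply: ltrD => //.
  exact: le_lt_trans xt md.
exact: Hd.
Qed.

(** Disjoint compact arcs have positive distance; [segment_covering] is used once for each
    parameter. *)
Lemma near_far c1 c2 : {within `[0, 1], continuous c1} ->
  {within `[0, 1], continuous c2} ->
  (forall s t : R, s \in `[0, 1] -> t \in `[0, 1] -> c1 s != c2 t) ->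
  \forall m \near \oo, forall s, s \in `[0, 1] -> forall t, t \in `[0, 1] ->
    coord_far m.+1%:R^-1 (c1 s) (c2 t).
Proof.
move=> cc1 cc2 dis; apply: segment_covering => s s01.
(* Twice the final margin: one half is spent on moving s to a nearby parameter. *)
have : \forall m \near \oo, forall t, t \in `[0, 1] ->
    coord_far (m.+1%:R^-1 + m.+1%:R^-1) (c1 s) (c2 t).
  apply: segment_covering => t t01.
  have [e e0 fe] := coord_far_neq (dis s t s01 t01).
  have /nbhs_ballP[d /= d0 Hd] := near_close cc2 t01 e0.
  exists d => //; have e2 : 0 < e / 2 by rewrite divr_gt0.
  apply: filterS (near_natSinv e2) => m me x tx x01.
  have {}Hd := Hd x tx x01.
  have : coord_far e (c1 s) (c2 x).
    have farC y z : coord_far e y z = coord_far e z y by rewrite /coord_far !(distrC y.1) !(distrC y.2).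
    rewrite farC; apply: coord_far_close Hd; move: fe.
    by rewrite /coord_far !(distrC (c1 s).1) !(distrC (c1 s).2).
  apply: coord_far_le; rewrite [e](_ : _ = e / 2 + e / 2); last by lra.
  by rewrite lerD// ltW.
move=> [N _ HN]; have n0 : 0 < N.+1%:R^-1 :> R by rewrite invr_gt0.
have /nbhs_ballP[d /= d0 Hd] := near_close cc1 s01 n0.
exists d => //; exists N => // m /= Nm x sx x01 t t01.
apply: (@coord_far_le _ (N.+1%:R^-1)).
  by rewrite lef_pV2 ?posrE// ler_nat.
apply: (coord_far_close (HN N (leqnn N) t t01)).
exact: Hd.
Qed.

Definition sample c m (i : nat) : R * R := c (i%:R / m.+1%:R).

Lemma near_parity c1 c2 : {within `[0, 1], continuous c1} ->
  {within `[0, 1], continuous c2} ->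
  (forall s t : R, s \in `[0, 1] -> t \in `[0, 1] -> c1 s != c2 t) ->
  \forall m \near \oo,
    ray_parity (c2 0) (sample c1 m) m.+1 (+) ray_parity (c2 1) (sample c1 m) m.+1 (+)
    (ray_parity (c1 0) (sample c2 m) m.+1 (+) ray_parity (c1 1) (sample c2 m) m.+1) =
    lexlt (c2 0) (c1 0) (+) lexlt (c2 1) (c1 0) (+)
      (lexlt (c2 0) (c1 1) (+) lexlt (c2 1) (c1 1)).
Proof.
(* The separation 1/(N + 1) is fixed first, as 3e; the sampling is then refined until its steps are
   shorter than e. *)
move=> cc1 cc2 dis; have [N _ /(_ N (leqnn N)) HN] := near_far cc1 cc2 dis.
have [e e0 E3] : exists2 e : R, 0 < e & N.+1%:R^-1 = 3 * e.
  by exists (N.+1%:R^-1 / 3); rewrite ?divr_gt0 ?invr_gt0// mulrC divfK.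
rewrite E3 in HN.
apply: filterS (filterI (near_step_close cc1 e0) (near_step_close cc2 e0)).
move=> m [s1 s2].
have m0 : 0 < m.+1%:R :> R by [].
have S0 c : sample c m 0 = c 0 by rewrite /sample mul0r.
have S1 c : sample c m m.+1 = c 1 by rewrite /sample divff// gt_eqF.
have i01 i : (i <= m.+1)%N -> (i%:R / m.+1%:R : R) \in `[0, 1].
  by move=> im; rewrite in_itv /= divr_ge0//= ler_pdivrMr// mul1r ler_nat.
have st i : `|i%:R / m.+1%:R - i.+1%:R / m.+1%:R| <= m.+1%:R^-1 :> R.
  rewrite -mulrBl -natr1 opprD addrA subrr add0r normrM normrN normr1 mul1r.
  by rewrite ger0_norm// invr_ge0.
have := @ray_parity_square R e (sample c1 m) (sample c2 m) m.+1.
rewrite !S0 !S1; apply.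
- by move=> i im; apply: s1 => //; apply: i01 => //; apply: ltnW.
- by move=> i im; apply: s2 => //; apply: i01 => //; apply: ltnW.
by move=> i j im jm; apply: HN; apply: i01.
Qed.

End Paths.

(** * A crossing in every drawing of K_5 *)

Section CompleteGraph5.
Variables (R : realType) (G : sgraph) (D : drawing R G) (v : 'I_5 -> G).
Hypothesis v_inj : injective v.
Hypothesis v_adj : forall i j, i != j -> adj (v i) (v j).

Lemma adj_edges (x y : G) : adj x y -> [set x; y]%SET \in edges G.
Proof. by move=> xy; apply/imsetP; exists (x, y). Qed.

(** [crosses] concerns interior points only; common points involving an endpoint are excluded
    because interiors avoid the vertices and the two edges share no vertex. *)
Lemma disjoint_curves (x y z w : G) : adj x y -> adj z w ->
  [&& x != z, x != w, y != z & y != w] ->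
  ~ crosses D [set x; y]%SET [set z; w]%SET ->
  forall s t : R, s \in `[0, 1] -> t \in `[0, 1] ->
    curve D [set x; y]%SET s != curve D [set z; w]%SET t.
Proof.
move=> xy zw /and4P[xz xw yz yw] ncr s t s01 t01.
have exy := adj_edges xy; have ezw := adj_edges zw.
have split01 (r : R) : r \in `[0, 1] -> [\/ r = 0, r = 1 | r \in `]0, 1[].
  rewrite !in_itv /= => /andP[r0 r1].
  have [->|n0] := eqVneq r 0; first by constructor 1.
  have [->|n1] := eqVneq r 1; first by constructor 2.
  by constructor 3; rewrite !lt_neqAle n1 r1 eq_sym n0 r0.
have ends a b : adj a b -> forall r : R, r \in `[0, 1] -> r \notin `]0, 1[ ->
    exists2 c, c \in [set a; b]%SET & curve D [set a; b]%SET r = position D c.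
  move=> ab r /split01[->|->|->] // _; case: (curve_ends D ab) => -[E0 E1].
  - by exists a; rewrite ?set21.
  - by exists b; rewrite ?set22.
  - by exists b; rewrite ?set22.
  - by exists a; rewrite ?set21.
have [s01'|s01'] := boolP (s \in `]0, 1[).
  have [t01'|t01'] := boolP (t \in `]0, 1[).
    by apply/eqP => E; apply: ncr; exists s, t.
  have [c _ ->] := ends _ _ zw t t01 t01'.
  exact: curve_avoids.
have [c cxy ->] := ends _ _ xy s s01 s01'.
have [t01'|t01'] := boolP (t \in `]0, 1[).
  by rewrite eq_sym; apply: curve_avoids.
have [d dzw ->] := ends _ _ zw t t01 t01'.
rewrite (inj_eq (@position_inj _ _ D)).
by move: cxy dzw; rewrite !inE => /orP[]/eqP-> /orP[]/eqP->.
Qed.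

(** Without a crossing of disjoint edges, [near_parity] holds for each pair of them once the
    sampling is fine. A single m serves the finitely many pairs, and [K5_parity] is contradicted. *)
Lemma K5_crossing : exists i j k l : 'I_5,
  [/\ i != j, k != l, [&& i != k, i != l, j != k & j != l] &
    crosses D [set v i; v j]%SET [set v k; v l]%SET].
Proof.
apply: contrapT => ncr.
pose rel m (i j k l : 'I_5) :=
  let K a b c := ray_parity (position D (v c)) (sample (curve D [set v a; v b]%SET) m) m.+1 in
  let s a b := lexlt (position D (v b)) (position D (v a)) in
  K i j k (+) K i j l (+) (K k l i (+) K k l j) = s i k (+) s i l (+) (s j k (+) s j l).
have near_rel i j k l : i != j -> k != l -> [&& i != k, i != l, j != k & j != l] ->
    \forall m \near \oo, rel m i j k l.
  move=> ij kl dis.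
  have dis' : [&& v i != v k, v i != v l, v j != v k & v j != v l].
    by rewrite !(inj_eq v_inj).
  have aij := v_adj ij; have akl := v_adj kl.
  have dcur := disjoint_curves aij akl dis' (fun cr => ncr
     (ex_intro _ i (ex_intro _ j (ex_intro _ k (ex_intro _ l (And4 ij kl dis cr)))))).
  apply: filterS (near_parity (curve_continuous (adj_edges aij))
    (curve_continuous (adj_edges akl)) dcur) => m; rewrite /rel.
  (* Reversing an arc only permutes the terms of the relation, so either parametrization will do. *)
  by case: (curve_ends D aij) => -[-> ->]; case: (curve_ends D akl) => -[-> ->];
    do 4!case: (ray_parity _ _ _); do 4!case: (lexlt _ _).
have : \forall m \near \oo, forall p : 'I_5 * 'I_5 * ('I_5 * 'I_5),
    p.1.1 != p.1.2 -> p.2.1 != p.2.2 ->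
    [&& p.1.1 != p.2.1, p.1.1 != p.2.2, p.1.2 != p.2.1 & p.1.2 != p.2.2] ->
    rel m p.1.1 p.1.2 p.2.1 p.2.2.
  apply: filter_forall => -[[i j] [k l]] /=.
  have [?|/negP ?] := boolP (i != j); last by near=> m.
  have [?|/negP ?] := boolP (k != l); last by near=> m.
  have [?|/negP ?] := boolP [&& i != k, i != l, j != k & j != l]; last by near=> m.
  by apply: filterS (near_rel i j k l _ _ _).
move=> [m _ /(_ m (leqnn m)) Hm].
apply: (@K5_parity
  (fun i j k => ray_parity (position D (v (inord k)))
     (sample (curve D [set v (inord i); v (inord j)]%SET) m) m.+1)
  (fun i j => lexlt (position D (v (inord j))) (position D (v (inord i))))).
  move=> i j /andP[ij j5]; rewrite lexlt_asym//.
  rewrite (inj_eq (@position_inj _ _ D)) (inj_eq v_inj) -val_eqE /= !inordK//; last by lia.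
  by rewrite neq_ltn ij orbT.
move=> i j k l /andP[ij j5] /andP[kl l5] dis.
have n a b : (a < 5)%N -> (b < 5)%N -> a != b -> (inord a : 'I_5) != inord b.
  by move=> a5 b5; rewrite -val_eqE /= !inordK.
apply: (Hm ((inord i, inord j), (inord k, inord l))) => /=.
- by apply: n; lia.
- by apply: n; lia.
by case/and4P: dis => *; apply/and4P; split; apply: n => //; lia.
Unshelve. all: by end_near. Qed.

End CompleteGraph5.

(** * Crossing number *)

(** Nonemptiness rules out the default value 0; it is established below both for drawings and for
    box representations. *)
Lemma nat_minP (A : set nat) : A !=set0 ->
  A (nat_min A) /\ forall m, A m -> (nat_min A <= m)%N.
Proof.
move=> [n An]; apply: (@xgetPex _ 0%N [set n | A n /\ forall m, A m -> (n <= m)%N]).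
have exA : exists n, `[< A n >] by exists n; apply/asboolP.
case: (ex_minnP exA) => m /asboolP Am min; exists m; split=> // k Ak.
by apply: min; apply/asboolP.
Qed.

Section ConvexDrawing.
Variables (R : realType) (G : sgraph).
Implicit Types (u v : G) (f : {set G}) (s t : R).

Let x v : R := (enum_rank v : nat)%:R.

Let x_inj : injective x.
Proof. by move=> u v /eqP; rewrite eqr_nat => /eqP/val_inj/enum_rank_inj. Qed.

Definition chord u v s : R * R :=
  ((1 - s) * x u + s * x v, (1 - s) * x u ^+ 2 + s * x v ^+ 2).

(** An edge is an unordered pair, so an orientation has to be picked; the constant default never
    occurs on edges. *)
Definition chord_of f : R -> R * R :=
  if [pick p : G * G | adj p.1 p.2 && (f == [set p.1; p.2]%SET)] is Some p
  then chord p.1 p.2 else fun=> (0, 0).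

Lemma chord_ofP f : f \in edges G ->
  exists2 p : G * G, adj p.1 p.2 & f = [set p.1; p.2]%SET /\ chord_of f = chord p.1 p.2.
Proof.
move=> /imsetP[p pa ->]; rewrite /chord_of; case: pickP => [p'|/(_ p)].
  by move=> /andP[a /eqP E]; exists p'.
by rewrite eqxx andbT (_ : adj p.1 p.2) //.
Qed.

Lemma adj_neq u v : adj u v -> u != v.
Proof. by apply: contraTneq => ->; rewrite adj_irr. Qed.

Lemma set2_eqP (T : finType) (a b c d : T) : a != b -> [set a; b]%SET = [set c; d]%SET ->
  (a = c /\ b = d) \/ (a = d /\ b = c).
Proof.
move=> ab E.
have : a \in [set c; d]%SET by rewrite -E set21.
have : b \in [set c; d]%SET by rewrite -E set22.
rewrite !inE => /orP[]/eqP Eb /orP[]/eqP Ea; rewrite Ea Eb.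
- by rewrite Ea Eb eqxx in ab.
- by right.
- by left.
- by rewrite Ea Eb eqxx in ab.
Qed.

(** The vertices are put on the parabola y = x^2 and joined by straight chords: by strict convexity
    no chord passes through a third vertex. *)
Lemma exists_drawing : inhabited (drawing R G).
Proof.
pose pos v : R * R := (x v, x v ^+ 2).
suff : [/\ injective pos,
    forall f, f \in edges G -> {within `[0, 1], continuous (chord_of f)},
    forall f, f \in edges G -> {in `[0, 1] &, injective (chord_of f)},
    forall u v, adj u v ->
      (chord_of [set u; v]%SET 0 = pos u /\ chord_of [set u; v]%SET 1 = pos v) \/
      (chord_of [set u; v]%SET 0 = pos v /\ chord_of [set u; v]%SET 1 = pos u) &
    forall f, f \in edges G -> forall s, s \in `]0, 1[ -> forall v, chord_of f s != pos v].
  by case=> p1 p2 p3 p4 p5; exact: inhabits (Drawing p1 p2 p3 p4 p5).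
split.
- by move=> u v [/x_inj].
- move=> f /chord_ofP[p _ [_ ->]]; apply: continuous_subspaceT => s.
  have lin (a b : R) : (fun t : R => (1 - t) * a + t * b) @ s --> (1 - s) * a + s * b.
    apply: cvgD; apply: cvgM; try exact: cvg_cst; try exact: cvg_id.
    by apply: cvgB; [exact: cvg_cst|exact: cvg_id].
  exact: (cvg_pair (lin _ _) (lin _ _)).
- move=> f /chord_ofP[p /adj_neq pa [_ ->]] s t _ _ [E _].
  have : (s - t) * (x p.2 - x p.1) = 0 by lra.
  move/eqP; rewrite mulf_eq0 !subr_eq0 => /orP[/eqP//|/eqP/x_inj E'].
  by rewrite E' eqxx in pa.
- move=> u v uv; have [p pa [E ->]] := chord_ofP (adj_edges uv).
  have c0 a b : chord a b 0 = pos a by rewrite /chord /pos; congr pair; ring.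
  have c1 a b : chord a b 1 = pos b by rewrite /chord /pos; congr pair; ring.
  by rewrite c0 c1; case: (set2_eqP (adj_neq uv) E) => -[-> ->]; [left|right].
move=> f /chord_ofP[p /adj_neq pa [_ ->]] s; rewrite in_itv /= => /andP[s0 s1] v.
apply/eqP => -[E1 E2].
(* The right side measures the height of the chord above the parabola and would vanish at a
   vertex. *)
have : s * (1 - s) * (x p.1 - x p.2) ^+ 2 =
    ((1 - s) * x p.1 ^+ 2 + s * x p.2 ^+ 2) - ((1 - s) * x p.1 + s * x p.2) ^+ 2 by ring.
rewrite E1 E2 subrr.
move/eqP; rewrite !mulf_eq0 !subr_eq0 (gt_eqF s0) (gt_eqF s1) /=.
by rewrite orbb (inj_eq x_inj) (negbTE pa).
Qed.

Lemma crossing_numberP :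
  (exists D : drawing R G, crossing_number R G = #|crossing_pairs D|) /\
  forall D : drawing R G, (crossing_number R G <= #|crossing_pairs D|)%N.
Proof.
have [D0] := exists_drawing.
have [|[D _ E] min] := @nat_minP [set #|crossing_pairs D| | D in [set: drawing R G]].
  by exists #|crossing_pairs D0|, D0.
by split; [exists D|move=> D'; apply: min; exists D'].
Qed.

Lemma crossing_number_le_edges : (crossing_number R G <= #|edges G| ^ 2)%N.
Proof.
have [[D ->] _] := crossing_numberP.
apply: leq_trans (leq_imset_card _ _) _; rewrite -mulnn -cardsX.
by apply: subset_leq_card; apply/fintype.subsetP => p; rewrite !inE => /and4P[-> ->].
Qed.

(** Each copy contributes a crossing pair made of its own edges, and the copies share no vertices,
    so these pairs are distinct. *)
Lemma crossing_number_ge_K5s N (w : 'I_N * 'I_5 -> G) : injective w ->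
  (forall j a b, a != b -> adj (w (j, a)) (w (j, b))) ->
  (N <= crossing_number R G)%N.
Proof.
move=> w_inj w_adj; have [[D ->] _] := crossing_numberP.
have /fin_all_exists[P PP] (j : 'I_N) : exists P : {set {set G}}, P \in crossing_pairs D /\
    (exists2 e, e \in P & exists a, w (j, a) \in e) /\
    (forall e y, e \in P -> y \in e -> exists b, y = w (j, b)).
  have [|a b ab|a [b [k [l [ab kl dis cr]]]]] := @K5_crossing R G D (fun a => w (j, a)).
  - by move=> a b /w_inj[].
  - exact: w_adj.
  exists [set [set w (j, a); w (j, b)]; [set w (j, k); w (j, l)]]%SET; split.
    apply/imsetP; exists ([set w (j, a); w (j, b)], [set w (j, k); w (j, l)])%SET => //.
    rewrite inE /= !adj_edges ?w_adj//=; apply/andP; split; last exact/asboolP.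
    apply/eqP => /setP/(_ (w (j, a))); rewrite set21 !inE !(inj_eq w_inj) !xpair_eqE eqxx /=.
    by case/and4P: dis => /negbTE-> /negbTE->.
  split; first by exists [set w (j, a); w (j, b)]%SET; [|exists a]; rewrite set21.
  move=> e y; rewrite !inE => /orP[]/eqP->; rewrite !inE => /orP[]/eqP->;
    by [exists a|exists b|exists k|exists l].
have P_inj : injective P.
  move=> j j' E; have [_ [[e eP [a ae]] _]] := PP j.
  have [_ [_ H]] := PP j'; rewrite E in eP.
  by have [b /w_inj[]] := H _ _ eP ae.
rewrite -[X in (X <= _)%N]card_ord -(card_imset predT P_inj); apply: subset_leq_card.
by apply/fintype.subsetP => _ /imsetP[j _ ->]; case: (PP j).
Qed.

End ConvexDrawing.

(** * Boxicity *)

Section Boxicity.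
Variables (R : realType) (G : sgraph).

Lemma box_meetP k (a b a' b' : 'rV[R]_k) :
  (forall i, a 0 i <= b 0 i) -> (forall i, a' 0 i <= b' 0 i) ->
  box a b `&` box a' b' !=set0 <->
  forall i, a 0 i <= b' 0 i /\ a' 0 i <= b 0 i.
Proof.
move=> ab ab'; split.
  move=> [x [xb xb']] i; have := xb i; have := xb' i; rewrite !in_itv /=.
  move=> /andP[h1 h2] /andP[h3 h4].
  by split; [exact: le_trans h3 h2|exact: le_trans h1 h4].
move=> H; exists (\row_i Num.max (a 0 i) (a' 0 i)); split=> i;
  by rewrite in_itv /= mxE le_max lexx ?orbT ge_max ?ab ?ab' ?(H i).1 ?(H i).2.
Qed.

(** The minimum is attained because one coordinate per vertex suffices: in the coordinate of w, the
    vertex w gets [0, 0], its neighbours [0, 1] and the others [1, 1]. *)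
Lemma boxicityP : exists a b : G -> 'rV[R]_(boxicity R G), box_representation a b.
Proof.
have [|//] := @nat_minP [set k | exists a b : G -> 'rV[R]_k, box_representation a b].
pose a (v : G) : 'rV[R]_#|G| :=
  \row_i (if (v == enum_val i) || adj v (enum_val i) then 0 else 1).
pose b (v : G) : 'rV[R]_#|G| := \row_i (if v == enum_val i then 0 else 1).
have ab v i : a v 0 i <= b v 0 i.
  by rewrite !mxE; case: (v == _); case: (adj _ _).
exists #|G|, a, b; split=> // u v uv.
have := @box_meetP _ _ _ _ _ (ab u) (ab v) => HM.
split=> [auv|/HM/(_ (enum_rank u))[_]].
  apply/HM => i; rewrite !mxE.
  have [Eu|_] := eqVneq u (enum_val i).
    have [Ev|_] := eqVneq v (enum_val i); first by rewrite Eu -Ev eqxx in uv.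
    by rewrite -Eu adj_sym auv.
  have [Ev|_] := eqVneq v (enum_val i); first by rewrite -Ev auv.
  by case: (adj u _); case: (adj v _).
rewrite !mxE enum_rankK eqxx eq_sym (negbTE uv) /= adj_sym.
by case: ifP => //; rewrite ler10.
Qed.

(** Two intervals are disjoint when one lies entirely to the left of the other, so each coordinate
    covers non-edges by two Ferrers sets. If twice the boxicity were at most [k], then [k] of them
    would cover all non-edges. *)
Lemma boxicity_gt n k (E : {set 'I_n * 'I_n}) (p r : 'I_n -> G) :
  (forall x y, p x != r y) -> (forall x y, adj (p x) (r y) = ((x, y) \in E)) ->
  (forall f g : 'I_k -> 'I_n -> R,
    (forall i x y, f i x < g i y -> (x, y) \notin E) ->
    exists x y, (x, y) \notin E /\ forall i, ~~ (f i x < g i y)) ->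
  (k < 2 * boxicity R G)%N.
Proof.
move=> pr prE H; rewrite ltnNge; apply/negP => Kk.
have [a [b [ab rep]]] := boxicityP.
set K := boxicity R G in Kk a b ab rep.
have adjP x y : reflect
    (forall i, a (p x) 0 i <= b (r y) 0 i /\ a (r y) 0 i <= b (p x) 0 i) ((x, y) \in E).
  rewrite -prE; apply: (iffP idP) => [/(rep _ _ (pr x y))/box_meetP|M].
    by apply; exact: ab.
  by apply/(rep _ _ (pr x y))/box_meetP => //; exact: ab.
(* Indices below K are for left vertices whose box lies to the left, the next K for the opposite
   position, with signs changed to keep the inequality; the remaining indices give the empty set 0 <
   0. *)
pose f (i : 'I_k) x : R :=
  if insub (i : nat) is Some j then b (p x) 0 j
  else if insub (i - K)%N is Some j then - a (p x) 0 j else 0.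
pose g (i : 'I_k) y : R :=
  if insub (i : nat) is Some j then a (r y) 0 j
  else if insub (i - K)%N is Some j then - b (r y) 0 j else 0.
have [|x [y [/adjP nE nfg]]] := H f g.
  move=> i x y; rewrite /f /g; case: insubP => [j _ _ lt|_].
    by apply/adjP => /(_ j)[_]; rewrite leNgt lt.
  case: insubP => [j _ _|_]; last by rewrite ltxx.
  by rewrite ltrN2 => lt; apply/adjP => /(_ j)[]; rewrite leNgt lt.
apply: nE => j; split; rewrite leNgt; apply/negP => lt.
  have ik : (K + j < k)%N by have := ltn_ord j; lia.
  have := nfg (Ordinal ik); rewrite /f /g /= insubN -?leqNgt ?leq_addr// addKn valK.
  by rewrite ltrN2 lt.
have ik : (j < k)%N by have := ltn_ord j; lia.
by have := nfg (Ordinal ik); rewrite /f /g /= valK lt.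
Qed.

End Boxicity.

(** * A bipartite graph together with disjoint copies of K_5 *)

Section Construction.
Variables (n N : nat) (E : {set 'I_n * 'I_n}).
Local Notation V := ('I_n + 'I_n + 'I_N * 'I_5)%type.

Definition bip_K5s_adj : rel V := fun u v =>
  match u, v with
  | inl (inl x), inl (inr y) => (x, y) \in E
  | inl (inr y), inl (inl x) => (x, y) \in E
  | inr (j, a), inr (j', a') => (j == j') && (a != a')
  | _, _ => false
  end.

Lemma bip_K5s_sym : symmetric bip_K5s_adj.
Proof.
by move=> [[x|x]|[j a]] [[y|y]|[j' a']] //=; rewrite (eq_sym j) (eq_sym a).
Qed.

Lemma bip_K5s_irr : irreflexive bip_K5s_adj.
Proof. by move=> [[x|x]|[j a]] //=; rewrite !eqxx. Qed.

Definition bip_K5s : sgraph := SGraph bip_K5s_sym bip_K5s_irr.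

(** The crude factor 25 counts all ordered pairs of vertices in each copy of K_5. *)
Lemma card_edges_bip_K5s : (#|edges bip_K5s| <= #|E| + 25 * N)%N.
Proof.
pose h1 (p : 'I_n * 'I_n) : {set bip_K5s} := [set inl (inl p.1); inl (inr p.2)]%SET.
pose h2 (p : 'I_N * ('I_5 * 'I_5)) : {set bip_K5s} :=
  [set inr (p.1, p.2.1); inr (p.1, p.2.2)]%SET.
have sub : edges bip_K5s \subset (h1 @: E)%SET :|: (h2 @: [set: 'I_N * ('I_5 * 'I_5)])%SET.
  apply/fintype.subsetP => _ /imsetP[[[[x|x]|[j a]] [[y|y]|[j' a']]] + ->];
    rewrite inE //= => h; rewrite inE.
  - by apply/orP; left; apply/imsetP; exists (x, y) => //; rewrite /h1.
  - by apply/orP; left; apply/imsetP; exists (y, x) => //; rewrite /h1 finset.setUC.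
  - case/andP: h => /eqP <- _; apply/orP; right.
    by apply/imsetP; exists (j, (a, a')); rewrite ?finset.in_setT.
apply: leq_trans (subset_leq_card sub) _.
apply: leq_trans (leq_card_setU _ _).1 _; apply: leq_add; first exact: leq_imset_card.
apply: leq_trans (leq_imset_card _ _) _.
by rewrite cardsT !card_prod !card_ord mulnC.
Qed.

Lemma crossing_number_bip_K5s (R : realType) : (N <= crossing_number R bip_K5s)%N.
Proof.
apply: (@crossing_number_ge_K5s R bip_K5s N (fun p => inr p)).
  by move=> p p' [].
by move=> j a b ab /=; rewrite eqxx.
Qed.

End Construction.

End Topology.

(** * Asymptotics *)

Section Estimates.
Variable R : realType.

Lemma ln2_le1 : ln (2 : R) <= 1.
Proof. by have := @le_ln1Dx R 1 ltac:(lra); rewrite (_ : 1 + 1 = 2); lra. Qed.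

Lemma ln4_ge1 : 1 <= ln (4 : R).
Proof.
have le : ln (2^-1 : R) <= - 2^-1.
  have := @le_ln1Dx R (- 2^-1) ltac:(lra).
  by have -> : 1 + - 2^-1 = 2^-1 :> R by lra.
have E2 : ln (2^-1 : R) = - ln 2 by rewrite lnV// posrE.
have E4 : ln (4 : R) = ln 2 *+ 2.
  by rewrite -lnXn// (_ : 4 = 2 ^+ 2)// expr2; lra.
rewrite E4 mulr2n; lra.
Qed.

Lemma powR_quarter (a : R) : 0 <= a -> (a `^ (1 / 4)) ^+ 4 = a.
Proof.
by move=> a0; rewrite -powR_mulrn ?powR_ge0// -powRrM mul1r mulVf// powRr1.
Qed.

Lemma powR_three_quarters (a : R) : a `^ (3 / 4) = (a `^ (1 / 4)) ^+ 3.
Proof.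
by rewrite -powR_mulrn ?powR_ge0// -powRrM; congr (_ `^ _); lra.
Qed.

(** With X = t^(1/4) and Y = (ln t)^(1/4), the ratio to be bounded is X Y^2. Here [t] is the
    crossing number, [K] the boxicity, and [4 <= t] ensures ln t >= 1. *)
Lemma estimates (p t K : nat) : (0 < p)%N -> (4 <= t)%N ->
  (t * p ^ 2 <= 4 * (16 ^ p) ^ 4)%N -> (16 ^ p <= 128 * K)%N ->
  768^-1 * (t%:R `^ (1 / 4) * ln (t%:R : R) `^ (3 / 4) / ln (t%:R : R) `^ (1 / 4)) <= K%:R
  /\ boxicity_bound R t <= 640 * 640 * ln (t%:R : R) `^ (1 / 4) * K%:R.
Proof.
move=> p0 t4 tp nK.
have t4R : 4 <= t%:R :> R by rewrite ler_nat.
have t0 : 0 < t%:R :> R by lra.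
have L1 : 1 <= ln (t%:R : R).
  by apply: le_trans ln4_ge1 _; rewrite ler_ln ?posrE.
have Lp : ln (t%:R : R) <= 18 * p%:R.
  have le2 : (t <= 2 ^ (18 * p))%N.
    apply: (@leq_trans (t * p ^ 2)%N); first by rewrite leq_pmulr// expn_gt0 p0.
    apply: leq_trans tp _; rewrite (_ : 16 = 2 ^ 4)%N// -!expnM.
    by rewrite (_ : 4 = 2 ^ 2)%N// -expnD leq_exp2l//; lia.
  apply: (@le_trans _ _ (ln ((2 : R) ^+ (18 * p)))).
    by rewrite ler_ln ?posrE ?exprn_gt0// -natrX ler_nat.
  rewrite lnXn// -[ln _ *+ _]mulr_natr natrM mulrC.
  by apply: ler_piMr; rewrite ?ln2_le1// mulr_ge0.
set X := t%:R `^ (1 / 4); set L := ln _ in L1 Lp *; set Y := L `^ (1 / 4).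
have X4 : X ^+ 4 = t%:R by apply: powR_quarter; lra.
have Y4 : Y ^+ 4 = L by apply: powR_quarter; lra.
have X0 : 0 <= X by apply: powR_ge0.
have Y0 : 0 < Y by apply: powR_gt0; lra.
have Y1 : 1 <= Y.
  by rewrite -(@ler_pXn2r _ 4)// ?nnegrE ?expr1n ?Y4// ltW.
have K1 : 1 <= K%:R :> R.
  by rewrite ler1n lt0n; apply: contraTneq nK => ->; rewrite muln0 leqn0 expn_eq0.
have XY : X * Y ^+ 2 <= 768 * K%:R.
  (* Fourth powers: t (ln t)^2 is at most 324 t p^2, hence at most 1296 n^4 = (6n)^4 with n =
     16^p. *)
  apply: (@le_trans _ _ (6 * (16 ^ p)%:R)).
    rewrite -(@ler_pXn2r _ 4)// ?nnegrE ?mulr_ge0 ?exprn_ge0// ?(ltW Y0)//.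
    rewrite exprMn X4 exprAC Y4 [(6 * _) ^+ 4]exprMn.
    have p20 : 0 < p%:R ^+ 2 :> R by rewrite exprn_gt0// ltr0n.
    have LL : L ^+ 2 <= 324 * p%:R ^+ 2.
      have -> : 324 * p%:R ^+ 2 = (18 * p%:R) ^+ 2 :> R by ring.
      by rewrite ler_pXn2r// ?nnegrE; lra.
    have := tp; rewrite -(ler_nat R) !natrM !natrX => tpR.
    apply: (@le_trans _ _ (324 * (t%:R * p%:R ^+ 2))).
      by rewrite [324 * _]mulrCA; apply: ler_wpM2l => //; lra.
    lra.
  have -> : 768 = 6 * 128 :> R by lra.
  rewrite -mulrA ler_pM2l// -natrM ler_nat//.
split.
  rewrite powR_three_quarters -/Y.
  have -> : X * Y ^+ 3 / Y = X * Y ^+ 2 by field; rewrite gt_eqF.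
  by rewrite ler_pdivrMl ?ltr0n.
rewrite /boxicity_bound -/X powR_three_quarters; set c := (Num.ceil _)%:~R; set Z := c `^ _.
(* The constant 16 = 2^4 is a convenient fourth power, which yields [ZY]. *)
have c5 : c <= 16 * L.
  have : c < ln (4 * t%:R) + 1 :> R by have := ceilB1_lt (ln (4 * t%:R : R)); rewrite intrB -/c; lra.
  rewrite lnM ?posrE// -/L.
  have : ln (4 : R) <= 3 by have := @le_ln1Dx R 3 ltac:(lra); rewrite (_ : 1 + 3 = 4); lra.
  lra.
have c0 : 0 <= c.
  rewrite /c ler0z ceil_ge0 lnM ?posrE// -/L; have := ln4_ge1; lra.
have Z4 : Z ^+ 4 = c by apply: powR_quarter.
have Z0 : 0 <= Z by apply: powR_ge0.
have ZY : Z <= 2 * Y.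
  rewrite -(@ler_pXn2r _ 4)// ?nnegrE ?Z4 ?mulr_ge0 ?(ltW Y0)//.
  by rewrite exprMn Y4; lra.
have Z3 : Z ^+ 3 <= 8 * Y ^+ 3.
  have -> : 8 * Y ^+ 3 = (2 * Y) ^+ 3 by ring.
  by rewrite ler_pXn2r// nnegrE mulr_ge0// ltW.
have XZ : X * Z ^+ 3 <= X * (8 * Y ^+ 3) by apply: ler_wpM2l.
have XYY : Y * (X * Y ^+ 2) <= Y * (768 * K%:R) by rewrite ler_pM2l.
have YK : 1 <= Y * K%:R by rewrite mulr_ege1.
have : X * (8 * Y ^+ 3) = 8 * (Y * (X * Y ^+ 2)) by ring.
move: XZ XYY YK.
have -> : Y * (768 * K%:R) = 768 * (Y * K%:R) by ring.
(* The constants add up to 66 * 8 * 768 + 6 = 405510, below 640 * 640 = 409600. *)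
rewrite -[640 * 640 * Y * _]mulrA; lra.
Qed.

End Estimates.

Theorem mainTheorem6 (R : realType) :
  exists c C : R, 0 < c /\ 0 < C /\
    forall N : nat, exists (G : sgraph) (t : nat),
      [/\ t = crossing_number R G,
          (N <= t)%N,
          (boxicity R G)%:R >=
            c * (t%:R `^ (1 / 4) * ln (t%:R : R) `^ (3 / 4)
                 / ln (t%:R : R) `^ (1 / 4))
        & boxicity_bound R t <=
            C * ln (t%:R : R) `^ (1 / 4) * (boxicity R G)%:R].
Proof.
exists 768^-1, (640 * 640); rewrite invr_gt0 mulr_gt0 ?ltr0n//; split=> //; split=> // N.
(* The copies of K_5 force the crossing number to be at least N and at least 4; [p] exceeds their
   number, so that their edges do not outweigh the bipartite part. *)
pose M := (N + 4)%N; pose p := (M + 25)%N.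
have p21 : (21 <= p)%N by rewrite /p; lia.
have k64 : (64 * (16 ^ p %/ 64) <= 16 ^ p)%N by rewrite mulnC leq_trunc_div.
have [E [cE H]] := random_bipartite p21 k64.
pose G := bip_K5s M E; exists G, (crossing_number R G).
have tM : (M <= crossing_number R G)%N := @crossing_number_bip_K5s _ M E R.
have [] := @estimates R p (crossing_number R G) (boxicity R G).
- by apply: leq_trans p21.
- by apply: leq_trans tM; rewrite leq_addl.
(* Here p times the number of edges is at most 2n^2, half of it for the copies of K_5, whose share
   is at most 25 M p <= (5p)^2 <= n^2. *)
- apply: leq_trans (leq_mul (crossing_number_le_edges R G) (leqnn _)) _.
  rewrite -expnMn (_ : (4 * (16 ^ p) ^ 4 = (2 * (16 ^ p) ^ 2) ^ 2)%N); last first.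
    by rewrite expnMn -!expnM.
  rewrite leq_exp2r// mulnC.
  apply: leq_trans (leq_mul (leqnn p) (card_edges_bip_K5s M E)) _.
  rewrite mulnDr mul2n -addnn leq_add//.
  apply: (@leq_trans ((5 * p) ^ 2)%N).
    by rewrite expnMn mulnCA leq_mul// -mulnn leq_mul// leq_addr.
  rewrite leq_exp2r//; have := ltn_expl p (isT : 1 < 2)%N.
  have -> : (16 ^ p = 2 ^ p * 8 ^ p)%N by rewrite -expnMn.
  have : (8 <= 8 ^ p)%N by rewrite -[X in (X <= _)%N]expn1 leq_pexp2l//; apply: leq_trans p21.
  by move: (2 ^ p)%N (8 ^ p)%N => u w; nia.
(* For k the integer part of n/64, k < 2K gives n < 64(k + 1) <= 128K, where K is the boxicity. *)
- have := @boxicity_gt R G _ (16 ^ p %/ 64) E (fun x => inl (inl x)) (fun y => inl (inr y)).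
  move=> /(_ (fun _ _ => isT) (fun _ _ => erefl) (fun f g => H _ _ f g)).
  have := divn_eq (16 ^ p) 64; have := ltn_mod (16 ^ p) 64.
  by move: (16 ^ p)%N (16 ^ p %/ 64)%N (16 ^ p %% 64)%N => u v w; lia.
by move=> h1 h2; split=> //; apply: leq_trans tM; rewrite leq_addr.
Qed.
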